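(* Let $G$ be a finitely generated discrete group and let $\mathscr{T}(G)$ be one of the convolution algebras $\mathscr{O}(G)$ or $\mathscr{S}^k(G)$ for $k\in\mathbb{R}_+\cup\{\infty,\omega\}$. There is a canonical isomorphism of bornological chain complexes $$\mathscr{T}(G)\mathbin{\hat\otimes}_G C_\bullet(G)\cong\mathscr{T}C_\bullet(G).$$ If $P_\bullet\to\mathbb{R}$ is any free $\mathbb{R}[G]$-module resolution of the trivial module $\mathbb{R}$, then $\mathscr{T}(G)\mathbin{\hat\otimes}_G P_\bullet$ is bornologically homotopy equivalent to $\mathscr{T}C_\bullet(G)$ (that is, the chain maps and chain homotopies involved are bounded linear maps).
   Context: All vector spaces are real; $\mathbb{R}_+=[0,\infty)$. A bornology on a vector space $V$ is a collection of subsets, called bounded, such that subsets of bounded sets, finite sets, sums $S_1+S_2$ of bounded sets, and $\bigcup_{|t|\le\lambda}tS$ for $S$ bounded and $\lambda\in\mathbb{R}$ are bounded. All bornologies are complete and convex: every bounded subset is contained and bounded in some subspace $V_T$ with a Banach space norm for which $V_T\to V$ is bounded. A linear map is bounded if it maps bounded sets to bounded sets. The fine bornology on a vector space consists of the sets contained and bounded in a finite-dimensional subspace. $\hat\otimes$ is the projective complete bornological tensor product: it is universal for bounded bilinear maps into complete convex bornological vector spaces. $G$ carries the word length function $\ell$ for a finite generating set and the left invariant word metric $d(g,h)=\ell(g^{-1}h)$. Put $X=G$ in the following definitions. Function spaces. For $k\in\mathbb{R}_+$ let $\mathscr{S}^k(X)$ be the Banach space of $\phi\colon X\to\mathbb{R}$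 with $\|\phi\|^k=\sum_{x}|\phi(x)|(\ell(x)+1)^k<\infty$, with the bornology of norm-bounded subsets. Let $\mathscr{S}^\infty(X)=\bigcap_{k\in\mathbb{N}}\mathscr{S}^k(X)$; a subset is bounded if it is bounded for each norm $\|\cdot\|^k$, $k\in\mathbb{N}$. For $\alpha>1$ let $|||\phi|||_\alpha=\sum_x|\phi(x)|\alpha^{\ell(x)}$. Let $\mathscr{O}(X)$ be the space of $\phi$ with $|||\phi|||_\alpha<\infty$ for all $\alpha>1$; a subset is bounded if it is bounded for every $|||\cdot|||_\alpha$. Let $\mathscr{S}^\omega(X)$ be the space of $\phi$ with $|||\phi|||_\alpha<\infty$ for some $\alpha>1$; a subset is bounded if it is bounded for some $|||\cdot|||_\alpha$ with $\alpha>1$. For $X=G$ these are bornological unital algebras under convolution $*$, containing the group algebra $\mathbb{R}[G]$ (with the fine bornology). Chain complexes. $C_n(X)$ is the space of finitely supported functions $\phi\colon X^{n+1}\to\mathbb{R}$ with $\phi(x_0,\dots,x_n)=0$ if $x_j=x_{j+1}$ for some $j$, with the fine bornology. For $R\in\mathbb{N}$ let $\mathscr{T}C_n(X)_R$ be the space of functions $\phi\colon X^{n+1}\to\mathbb{R}$ such that $\phi(x_0,\dots,x_n)=0$ whenever $d(x_i,x_j)>R$ for some $i,j$ or $x_j=x_{j+1}$ for some $j$, and such that the function $x\mapsto\sum_{x_1,\dots,x_n}|\phi(x,x_1,\dots,x_n)|$ belongs to $\mathscr{T}(X)$. A subset is bounded if the associated set of functions in $\mathscr{T}(X)$ is bounded.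 Let $\mathscr{T}C_n(X)=\bigcup_R\mathscr{T}C_n(X)_R$, where a subset is bounded if it is contained and bounded in some $\mathscr{T}C_n(X)_R$. The boundary map $\delta$ on $C_\bullet(X)$ is $\delta(x_0,\dots,x_n)=\sum_{j=0}^n(-1)^j(x_0,\dots,\widehat{x_j},\dots,x_n)$, where a tuple denotes its characteristic function and tuples with two equal consecutive entries are regarded as $0$; it extends to bounded maps on $\mathscr{T}C_\bullet(X)$. The group $G$ acts diagonally on $C_n(G)$ and $\mathscr{T}C_n(G)$ by $g\cdot(x_0,\dots,x_n)=(gx_0,\dots,gx_n)$, which makes them modules over $\mathbb{R}[G]$ and $\mathscr{T}(G)$, respectively. Modules. A bornological left module over a bornological unital algebra $A$ is a bornological vector space $M$ with a unital module structure given by a bounded bilinear map $A\times M\to M$. A free module is one of the form $A\mathbin{\hat\otimes}V$ with $V$ a bornological vector space and the module structure $a\cdot(b\otimes v)=ab\otimes v$. A free resolution $P_\bullet\to M$ is a complex of free modules with bounded module homomorphisms as boundary maps and augmentation to $M$, such that the augmented complex has a bounded linear contracting homotopy. For a bornological left $\mathbb{R}[G]$-module $M$, $\mathscr{T}(G)\mathbin{\hat\otimes}_G M$ is the quotient of $\mathscr{T}(G)\mathbin{\hat\otimes}M$ by the closed linear subspace generated by $\phi*\delta_g\otimes m-\phi\otimes gm$ for $\phi\in\mathscr{T}(G)$, $g\in G$, $m\in M$; it is a left $\mathscr{T}(G)$-module by $\phi_1\cdot(\phi_2\otimes m)=\phi_1*\phi_2\otimes m$. *)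

(* Defs.v *)
From HB Require Import structures.
From mathcomp Require Import all_boot all_order all_algebra.
From mathcomp Require Import zify ring lra finmap.
From mathcomp Require Import all_classical all_reals all_analysis.
From mathcomp Require Import sesquilinear.

Set Implicit Arguments.
Unset Strict Implicit.
Unset Printing Implicit Defensive.
Import Order.TTheory GRing.Theory Num.Theory.
Import numFieldNormedType.Exports.
Local Open Scope classical_set_scope.
Local Open Scope ring_scope.

HB.mixin Record isBornological (R : realType) V of GRing.Lmodule R V := {
  born : set (set V);
  born_subset : forall A B : set V, A `<=` B -> born B -> born A;
  born_finite : forall A : set V, finite_set A -> born A;
  born_add : forall A B : set V,
    born A -> born B -> born [set x + y | x in A & y in B];
  born_scale : forall (l : R) (A : set V),
    born A -> born [set t *: x | t in [set t : R | `|t| <= l] & x in A] }.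

#[short(type="bornType")]
HB.structure Definition Bornological (R : realType) :=
  {V of isBornological R V & GRing.Lmodule R V}.

(* Completeness and convexity at once: [B] is a Banach space V_T, and the
   injection [i] presents it as a subspace of V; the images of the norm balls
   are bounded (V_T -> V is bounded) and A is norm-bounded in V_T. *)
HB.mixin Record isCompleteBornological (R : realType) V of Bornological R V := {
  born_complete : forall A : set V, born A ->
    exists (B : completeNormedModType R) (i : {linear B -> V}),
      [/\ injective i,
          forall r : R, born (i @` [set x : B | `|x| <= r]) &
          exists r : R, A `<=` i @` [set x : B | `|x| <= r]] }.

#[short(type="cbornType")]
HB.structure Definition CompleteBornological (R : realType) :=
  {V of isCompleteBornological R V & Bornological R V}.

Section Maps.
Variable R : realType.
Implicit Types V W : bornType R.

Definition bounded_map V W (f : V -> W) : Prop :=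
  forall A : set V, born A -> born (f @` A).

Definition bounded_map2 V W (Z : bornType R) (f : V -> W -> Z) : Prop :=
  forall (A : set V) (B : set W),
    born A -> born B -> born [set f x y | x in A & y in B].

(* Bornological (Mackey) convergence: convergence in norm in some V_T. *)
Definition born_cvg V (u : nat -> V) (l : V) : Prop :=
  exists2 A : set V, born A & exists2 e : nat -> R, e @ \oo --> (0 : R) &
    forall n, exists2 x, A x & u n - l = e n *: x.

Definition closed_subspace V (N : set V) : Prop :=
  [/\ N 0, forall (a : R) x y, N x -> N y -> N (a *: x + y) &
      forall u l, (forall n, N (u n)) -> born_cvg u l -> N l].

(* The smallest bornologically closed linear subspace containing A. *)
Definition closed_span V (A : set V) : set V :=
  [set x | forall N, closed_subspace N -> A `<=` N -> N x].

(* [q] exhibits Q as V / N with the quotient bornology. *)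
Definition is_quotient V (N : set V) (Q : bornType R) (q : {linear V -> Q}) :
    Prop :=
  [/\ forall y, exists x, q x = y,
      forall x, q x = 0 <-> N x &
      forall B : set Q, born B <-> exists2 A : set V, born A & B = q @` A].

(* [t] exhibits Z as the projective complete bornological tensor product of V
   and W, that is, as a universal target of bounded bilinear maps into complete
   convex bornological vector spaces. *)
Definition is_ctensor V W (Z : cbornType R) (t : {bilinear V -> W -> Z}) :
    Prop :=
  bounded_map2 t /\
  forall (E : cbornType R) (b : {bilinear V -> W -> E}), bounded_map2 b ->
    exists f : {linear Z -> E},
      [/\ bounded_map f, forall v w, f (t v w) = b v w &
          forall f' : {linear Z -> E}, bounded_map f' ->
            (forall v w, f' (t v w) = b v w) -> f' =1 f].

Lemma ctensor_eq V W (Z : cbornType R) (t : {bilinear V -> W -> Z}) :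
  is_ctensor t ->
  forall (E : cbornType R) (f f' : {linear Z -> E}),
    bounded_map f -> bounded_map f' ->
    (forall v w, f (t v w) = f' (t v w)) -> f =1 f'.
Proof.
move=> [bt ut] E f f' bf bf' ff'.
pose b v w := f (t v w).
have bb : bilinear_for *:%R *:%R b.
  by split=> [w a u v|v a u w]; rewrite /b ?linearPl ?linearPr linearP.
pose bM := bilinear_isBilinear.Build R V W E *:%R *:%R b bb.
pose B : {bilinear V -> W -> E} := HB.pack b bM.
have [|h [_ _ uh]] := ut E B.
  move=> A A' hA hA'; have := bf _ (bt _ _ hA hA'); apply: born_subset.
  by move=> _ [v Av [w A'w <-]]; exists (t v w) => //; exists v => //; exists w.
by move=> x; rewrite (uh f bf) // (uh f' bf') // => v w; rewrite -ff'.
Qed.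

End Maps.

Section FineBornology.
Variables (R : realType) (V : lmodType R).

(* A is the image of a bounded set of coordinates under a linear map R^n -> V;
   the range of that map is the finite-dimensional subspace containing A. *)
Definition fine_born : set (set V) :=
  [set A | exists (n : nat) (b : 'I_n -> V) (C : R), forall x, A x ->
     exists2 c : 'I_n -> R, forall i, `|c i| <= C & x = \sum_i c i *: b i].

Lemma fine_born_subset (A B : set V) : A `<=` B -> fine_born B -> fine_born A.
Proof. by move=> AB [n [b [C h]]]; exists n, b, C => x /AB /h. Qed.

Lemma fine_born_finite (A : set V) : finite_set A -> fine_born A.
Proof.
move=> /finite_seqP[s ->]; exists (size s), (tnth (in_tuple s)), 1 => x /= xs.
have ix : (index x s < size s)%N by rewrite index_mem.
exists (fun i => (i == Ordinal ix)%:R) => [i|].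
  by case: eqP => _; rewrite ?normr1 ?normr0.
rewrite (bigD1 (Ordinal ix)) //= eqxx scale1r big1 ?addr0.
  by rewrite (tnth_nth x) /= nth_index.
by move=> i /negbTE ->; rewrite scale0r.
Qed.

Lemma fine_born_add (A B : set V) : fine_born A -> fine_born B ->
  fine_born [set x + y | x in A & y in B].
Proof.
move=> [n [b [C hA]]] [m [b' [C' hB]]].
exists (n + m)%N, (fun i => match fintype.split i with inl j => b j | inr j => b' j end).
exists (Num.max C C') => _ [x /hA[c cC ->]] [y /hB[c' cC' ->]] <-.
exists (fun i => match fintype.split i with inl j => c j | inr j => c' j end) => [i|].
  by case: fintype.split => j; rewrite le_max ?cC ?cC' ?orbT.
rewrite big_split_ord /=; congr (_ + _); apply: eq_bigr => i _.
  by rewrite -[lshift m i]/(unsplit (inl i)) unsplitK.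
by rewrite -[rshift n i]/(unsplit (inr i)) unsplitK.
Qed.

Lemma fine_born_scale (l : R) (A : set V) : fine_born A ->
  fine_born [set t *: x | t in [set t : R | `|t| <= l] & x in A].
Proof.
move=> [n [b [C hA]]]; exists n, b, (l * C) => _ [t tl] [x /hA[c cC ->]] <-.
exists (fun i => t * c i) => [i|]; first by rewrite normrM ler_pM.
by rewrite scaler_sumr; apply: eq_bigr => i _; rewrite scalerA.
Qed.

End FineBornology.

Lemma fine_born_linear (R : realType) (V W : lmodType R) (f : {linear V -> W})
    (A : set V) : fine_born A -> fine_born (f @` A).
Proof.
move=> [n [b [C hA]]]; exists n, (f \o b), C => _ [x /hA[c cC ->] <-].
by exists c => //; rewrite linear_sum; apply: eq_bigr => i _; rewrite linearZ.
Qed.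

HB.instance Definition _ (R : realType) :=
  isBornological.Build R R^o (@fine_born_subset R R^o)
    (@fine_born_finite R R^o) (@fine_born_add R R^o) (@fine_born_scale R R^o).

Section WordLength.
Variable G : groupType.

Definition is_letter (S : seq G) : pred G :=
  fun x => (x \in S) || ((x^-1)%g \in S).

Definition generates (S : seq G) : Prop :=
  forall g, exists2 w, all (is_letter S) w & (\prod_(x <- w) x)%g = g.

Record generating_seq := GeneratingSeq {
  generators :> seq G;
  generatorsP : generates generators }.

Variable S : generating_seq.

Definition has_word (g : G) : pred nat := fun n =>
  `[< exists w, [/\ size w = n, all (is_letter S) w & (\prod_(x <- w) x)%g = g] >].

Lemma ex_word g : exists n, has_word g n.
Proof. by have [w Sw gw] := generatorsP S g; exists (size w); apply/asboolP; exists w. Qed.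

Definition word_length (g : G) : nat := ex_minn (ex_word g).

Definition word_dist (g h : G) : nat := word_length (g^-1 * h)%g.

Lemma word_lengthM g h : (word_length (g * h)%g <= word_length g + word_length h)%N.
Proof.
rewrite {1}/word_length; case: ex_minnP => m _; apply.
rewrite /word_length; case: ex_minnP => _ /asboolP[v [<- Sv <-]] _.
case: ex_minnP => _ /asboolP[w [<- Sw <-]] _; apply/asboolP; exists (v ++ w).
by rewrite size_cat all_cat Sv Sw big_cat.
Qed.

Lemma finite_ball r : finite_set [set g | (word_length g <= r)%N].
Proof.
pose L := undup (S ++ map (fun x => x^-1)%g S).
have LP x : is_letter S x -> x \in L.
  rewrite /is_letter mem_undup mem_cat => /orP[->//|Sx].
  by apply/orP; right; apply/mapP; exists (x^-1)%g; rewrite ?invgK.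
pose W k := iter k (fun l : seq G => (1%g : G) :: [seq (x * y)%g | x <- L, y <- l]) [:: 1%g].
apply: (@sub_finite_set _ _ [set` W r]); last exact: finite_seq.
move=> g /=; rewrite /word_length; case: ex_minnP => _ /asboolP[w [<- Sw <-]] _.
rewrite /W; elim: r w Sw => [|r IH] [|x w] /=; rewrite ?big_nil ?mem_head //.
move=> /andP[Sx Sw] wr; rewrite big_cons inE; apply/orP; right.
by apply: allpairs_f; [exact: LP|exact: IH].
Qed.

End WordLength.

Section Weights.
Variables (R : realType) (G : groupType) (S : generating_seq G).
Local Notation len := (word_length S).

(* The choices of the convolution algebra T(G): S^k for real k >= 0, S^oo, O and
   S^omega, in this order. *)
Inductive decay :=
  | DecayPoly of {nonneg R}
  | DecayRapid
  | DecayEntire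
  | DecayExp.

Definition poly_weight (k : R) (x : G) : R := (len x).+1%:R `^ k.
Definition exp_weight (a : R) (x : G) : R := a ^+ len x.

(* Norms are defined on [\bar R]-valued functions so that they also apply to the
   a priori possibly infinite sums [marginal f] below. *)
Definition weighted_norm (w : G -> R) (f : G -> \bar R) : \bar R :=
  (\esum_(x in [set: G]) (`|f x| * (w x)%:E))%E.

Definition norm_bounded (w : G -> R) (F : set (G -> \bar R)) : Prop :=
  exists C : R, forall f, F f -> (weighted_norm w f <= C%:E)%E.

Definition decay_bounded (t : decay) (F : set (G -> \bar R)) : Prop :=
  match t with
  | DecayPoly k => norm_bounded (poly_weight k%:num) F
  | DecayRapid => forall k : nat, norm_bounded (poly_weight k%:R) F
  | DecayEntire => forall a : R, 1 < a -> norm_bounded (exp_weight a) F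
  | DecayExp => exists2 a : R, 1 < a & norm_bounded (exp_weight a) F
  end.

Inductive is_weight : (G -> R) -> Prop :=
  | IsPolyWeight k : 0 <= k -> is_weight (poly_weight k)
  | IsExpWeight a : 1 < a -> is_weight (exp_weight a).

Lemma weight_ge0 w x : is_weight w -> 0 <= w x.
Proof.
case=> [k k0|a a1]; first exact: powR_ge0.
by rewrite exprn_ge0 // (le_trans ler01) // ltW.
Qed.

Lemma weight_comp w (r : nat) : is_weight w -> exists2 C, 0 <= C &
  forall x y, (word_dist S x y <= r)%N -> w y <= C * w x.
Proof.
move=> Ww.
have tri x y : (word_dist S x y <= r)%N -> (len y <= len x + r)%N.
  move=> xy; rewrite -{1}(mulVKg x y) (leq_trans (word_lengthM _ _ _)) //.
  by rewrite leq_add2l.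
case: Ww => [k k0|a a1].
  exists (r.+1%:R `^ k) => [|x y /tri xy]; first exact: powR_ge0.
  rewrite -powRM ?ler0n // ge0_ler_powR ?nnegrE ?mulr_ge0 ?ler0n //.
  rewrite -natrM ler_nat (leq_trans (_ : _ <= (len x + r).+1)%N) //.
  by rewrite mulSn addSn ltnS leq_add2l leq_pmulr.
exists (a ^+ r) => [|x y /tri xy].
  by rewrite exprn_ge0 // (le_trans ler01) // ltW.
by rewrite -exprD ler_weXn2l ?ltW // addnC.
Qed.

Lemma weighted_normD w f g : is_weight w ->
  (weighted_norm w (fun x => `|f x| + `|g x|) =
   weighted_norm w f + weighted_norm w g)%E.
Proof.
move=> Ww; rewrite /weighted_norm -esumD; last 2 first.
- by move=> x _; rewrite mule_ge0 ?lee_fin ?weight_ge0.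
- by move=> x _; rewrite mule_ge0 ?lee_fin ?weight_ge0.
by apply: eq_esum => x _; rewrite gee0_abs ?adde_ge0// ge0_muleDl.
Qed.

Lemma esumZl (T : choiceType) (A : set T) (c : R) (f : T -> \bar R) : 0 <= c ->
  (forall x, (0 <= f x)%E) ->
  (\esum_(x in A) (c%:E * f x) = c%:E * \esum_(x in A) f x)%E.
Proof.
move=> c0 f0; rewrite /esum -ereal_supZl //; last first.
  by apply/set0P; exists 0%E; exists set0; [exact: fsets_set0|rewrite fsbig_set0].
congr (ereal_sup _); rewrite eqEsubset; split => [_ [X [fX XA] <-]|].
  exists (\sum_(x \in X) f x)%E; first by exists X.
  by rewrite ge0_mule_fsumr.
move=> _ [_ [X [fX XA] <-] <-]; exists X => //.
by rewrite ge0_mule_fsumr.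
Qed.

Lemma le_weighted_norm w f g : is_weight w ->
  (forall x, (`|f x| <= `|g x|)%E) -> (weighted_norm w f <= weighted_norm w g)%E.
Proof.
move=> Ww fg; apply: le_esum => x _.
by rewrite lee_wpmul2r // lee_fin weight_ge0.
Qed.

Lemma weighted_normZ w f c : is_weight w -> 
  (weighted_norm w (fun x => c%:E * f x) = `|c|%:E * weighted_norm w f)%E.
Proof.
move=> Ww; rewrite /weighted_norm -esumZl //; last first.
  by move=> x; rewrite mule_ge0 ?lee_fin ?weight_ge0.
by apply: eq_esum => x _; rewrite abseM muleA.
Qed.

Lemma exp_weighted_norm_le a b f : 1 < a -> a <= b ->
  (weighted_norm (exp_weight a) f <= weighted_norm (exp_weight b) f)%E.
Proof.
move=> a1 ab; apply: le_esum => x _; apply: lee_wpmul2l => //.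
have a0 : 0 <= a by rewrite (le_trans ler01) // ltW.
by rewrite lee_fin; apply: lerXn2r; rewrite ?nnegrE ?(le_trans a0).
Qed.

Lemma decay_bounded2 t F1 F2 F :
  (forall w, is_weight w -> norm_bounded w F1 -> norm_bounded w F2 -> norm_bounded w F) ->
  decay_bounded t F1 -> decay_bounded t F2 -> decay_bounded t F.
Proof.
move=> H; case: t => [k| | |] /=.
- by apply: H; constructor.
- by move=> h1 h2 k; apply: H; [constructor; rewrite ler0n| |].
- by move=> h1 h2 a a1; apply: H; [constructor|exact: h1|exact: h2].
move=> [a a1 [C hC]] [b b1 [D hD]]; exists (Num.min a b); first by rewrite lt_min a1.
have m1 : 1 < Num.min a b by rewrite lt_min a1.
apply: H; first by constructor.
  by exists C => f /hC; apply: le_trans; rewrite exp_weighted_norm_le // ge_min lexx.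
by exists D => f /hD; apply: le_trans; rewrite exp_weighted_norm_le // ge_min lexx orbT.
Qed.

Lemma decay_bounded1 t F1 F :
  (forall w, is_weight w -> norm_bounded w F1 -> norm_bounded w F) ->
  decay_bounded t F1 -> decay_bounded t F.
Proof. by move=> H h; apply: (decay_bounded2 _ h h) => w Ww h1 _; apply: H. Qed.

Lemma decay_boundedT t F : (forall w, is_weight w -> norm_bounded w F) ->
  decay_bounded t F.
Proof.
move=> H; case: t => [k| | |] /=.
- by apply: H; constructor.
- by move=> k; apply: H; constructor.
- by move=> a a1; apply: H; constructor.
by exists 2; rewrite ?ltr1n //; apply: H; constructor; rewrite ltr1n.
Qed.

Lemma sub_decay_bounded t F F' : F `<=` F' -> decay_bounded t F' -> decay_bounded t F.
Proof. by move=> FF'; apply: decay_bounded1 => w _ [C h]; exists C => f /FF' /h. Qed.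

Lemma decay_boundedU t F F' : decay_bounded t F -> decay_bounded t F' ->
  decay_bounded t (F `|` F').
Proof.
apply: decay_bounded2 => w _ [C h] [C' h']; exists (Num.max C C') => f.
by case=> [/h|/h'] /le_trans; apply; rewrite lee_fin le_max lexx ?orbT.
Qed.

Lemma decay_bounded_finite t F : finite_set F ->
  (forall f, F f -> decay_bounded t [set f]) -> decay_bounded t F.
Proof.
move=> /finite_seqP[s ->]; elim: s => [|f s IH] h.
  by apply: decay_boundedT => w _; exists 0 => f; rewrite /= in_nil.
apply: (@sub_decay_bounded _ _ ([set f] `|` [set` s])).
  by move=> g /=; rewrite inE => /orP[/eqP ->|]; [left|right].
by apply: decay_boundedU; [apply: h => /=; rewrite mem_head|apply: IH => g gs; apply: h; rewrite /= inE gs orbT].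
Qed.

Lemma norm_bounded_dom w F F' (C : R) : is_weight w -> 0 <= C ->
  (forall f, F f -> exists2 g, F' g & (weighted_norm w f <= C%:E * weighted_norm w g)%E) ->
  norm_bounded w F' -> norm_bounded w F.
Proof.
move=> Ww C0 H [D hD]; exists (C * D) => f /H[g /hD gD] /le_trans; apply.
by rewrite EFinM lee_wpmul2l // lee_fin.
Qed.

Lemma norm_bounded_dom2 w F F1 F2 (C1 C2 : R) : is_weight w -> 0 <= C1 -> 0 <= C2 ->
  (forall f, F f -> exists2 g, F1 g & exists2 h, F2 h &
    (weighted_norm w f <= C1%:E * weighted_norm w g + C2%:E * weighted_norm w h)%E) ->
  norm_bounded w F1 -> norm_bounded w F2 -> norm_bounded w F.
Proof.
move=> Ww C10 C20 H [D hD] [D' hD']; exists (C1 * D + C2 * D').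
move=> f /H[g /hD gD [h /hD' gD']] /le_trans; apply.
by rewrite EFinD !EFinM leeD // lee_wpmul2l // lee_fin.
Qed.

End Weights.

Section DecaySeminorm.
Variables (R : realType) (G : groupType) (S : generating_seq G) (t : decay R).
Variables (V : lmodType R) (m : V -> G -> \bar R).
Hypothesis mD : forall u v x, (`|m (u + v)%R x| <= `|m u x| + `|m v x|)%E.
Hypothesis mZ : forall a u x, (`|m (a *: u)%R x| <= `|a|%:E * `|m u x|)%E.
Local Notation bdd A := (decay_bounded S t [set m u | u in A]).

Lemma weighted_norm_semiZD w a u v : is_weight S w ->
  (weighted_norm w (m (a *: u + v)%R) <=
   `|a|%:E * weighted_norm w (m u) + weighted_norm w (m v))%E.
Proof.
move=> Ww; have := @le_weighted_norm _ _ S w (m (a *: u + v))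
  (fun x => `|(a%:E * m u x)| + `|m v x|)%E Ww.
rewrite (weighted_normD _ _ Ww) (weighted_normZ _ _ Ww).
apply=> x; rewrite [leRHS]gee0_abs ?adde_ge0//.
by rewrite (le_trans (mD _ _ _)) // leeD2r // abseM mZ.
Qed.

Lemma weighted_norm_semiZ w a u : is_weight S w ->
  (weighted_norm w (m (a *: u)%R) <= `|a|%:E * weighted_norm w (m u))%E.
Proof.
move=> Ww; have := @le_weighted_norm _ _ S w (m (a *: u)) (fun x => `|(a%:E * m u x)|)%E Ww.
have -> : weighted_norm w (fun x => `|(a%:E * m u x)|)%E = weighted_norm w (fun x => a%:E * m u x)%E.
  by apply: eq_esum => x _; rewrite abse_id.
rewrite (weighted_normZ _ _ Ww); apply=> x.
by rewrite abse_id abseM mZ.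
Qed.

Lemma decay_bounded_lin a u v : bdd [set u] -> bdd [set v] -> bdd [set a *: u + v].
Proof.
apply: decay_bounded2 => w Ww; apply: (@norm_bounded_dom2 _ _ S w _ _ _ `|a| 1) => //.
move=> _ [_ -> <-]; exists (m u); first by exists u.
by exists (m v); [exists v|rewrite mul1e weighted_norm_semiZD].
Qed.

Lemma decay_bounded0 : bdd [set 0].
Proof.
apply: decay_boundedT => w Ww; exists 0 => _ [_ -> <-].
rewrite -{1}(scale0r 0) (le_trans (weighted_norm_semiZ _ _ Ww)) //.
by rewrite normr0 mul0e.
Qed.

Lemma decay_bounded_add A B : bdd A -> bdd B -> bdd [set u + v | u in A & v in B].
Proof.
apply: decay_bounded2 => w Ww; apply: (@norm_bounded_dom2 _ _ S w _ _ _ 1 1) => //.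
move=> _ [_ [u Au [v Bv <-]] <-]; exists (m u); first by exists u.
exists (m v); first by exists v.
by rewrite -{1}(scale1r u) (le_trans (weighted_norm_semiZD _ _ _ Ww)) // normr1 !mul1e.
Qed.

Lemma decay_bounded_scale l A : bdd A ->
  bdd [set s *: u | s in [set s : R | `|s| <= l] & u in A].
Proof.
have [l0|l0] := leP 0 l; last first.
  move=> _; apply: decay_boundedT => w Ww; exists 0 => f0 [u0 [s /= sl _] _].
  by have := le_lt_trans (le_trans (normr_ge0 s) sl) l0; rewrite ltxx.
apply: decay_bounded1 => w Ww; apply: (@norm_bounded_dom _ _ S w _ _ l) => //.
move=> _ [_ [s /= sl [u Au <-]] <-]; exists (m u); first by exists u.
rewrite (le_trans (weighted_norm_semiZ _ _ Ww)) // lee_wpmul2r ?lee_fin //.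
by apply: esum_ge0 => x _; rewrite mule_ge0 ?lee_fin ?(weight_ge0 _ Ww).
Qed.

Lemma decay_bounded_fin A : finite_set A -> (forall u, A u -> bdd [set u]) -> bdd A.
Proof.
move=> fA h; apply: decay_bounded_finite; first exact: finite_image.
by move=> _ [u Au <-]; rewrite -(image_set1 m u); exact: h.
Qed.

End DecaySeminorm.

Section DecaySpace.
Variables (R : realType) (G : groupType) (S : generating_seq G) (t : decay R).

(* f belongs to T(G) iff the relevant norms of f are finite, i.e. iff the
   singleton of f is bounded. *)
Definition in_decay : {pred G -> R} :=
  fun f => `[< decay_bounded S t [set EFin \o f | f in [set f]] >].

Let m (f : G -> R) : G -> \bar R := EFin \o f.
Let mD (f g : G -> R) x : (`|m (f + g)%R x| <= `|m f x| + `|m g x|)%E.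
Proof. by rewrite -EFinD lee_fin ler_normD. Qed.
Let mZ a (f : G -> R) x : (`|m (a *: f)%R x| <= `|a|%:E * `|m f x|)%E.
Proof. by rewrite -EFinM lee_fin normrM. Qed.

Lemma in_decay_submod : submod_closed in_decay.
Proof.
split=> [|a f g /asboolP hf /asboolP hg]; apply/asboolP.
  exact: (decay_bounded0 S t mZ).
exact: (decay_bounded_lin mD mZ a hf hg).
Qed.

HB.instance Definition _ := GRing.isSubmodClosed.Build R (G -> R) in_decay in_decay_submod.

Record decay_space := DecaySpace {
  decay_val :> G -> R;
  decay_valP : decay_val \in in_decay }.

HB.instance Definition _ := [isSub of decay_space for decay_val].
HB.instance Definition _ := [Choice of decay_space by <:].
HB.instance Definition _ := [SubChoice_isSubLmodule of decay_space by <:].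

Definition decay_space_born : set (set decay_space) :=
  [set A | decay_bounded S t [set EFin \o f | f in [set decay_val u | u in A]]].

Lemma decay_born_subset A B : A `<=` B -> decay_space_born B -> decay_space_born A.
Proof. by move=> AB; apply: sub_decay_bounded; do 2 apply: image_subset. Qed.

Lemma decay_born_finite A : finite_set A -> decay_space_born A.
Proof.
move=> fA; apply: (decay_bounded_fin (finite_image _ fA)) => _ [u Au <-].
exact/asboolP/(decay_valP u).
Qed.

Lemma decay_born_add A B : decay_space_born A -> decay_space_born B ->
  decay_space_born [set u + v | u in A & v in B].
Proof.
move=> hA hB; have := decay_bounded_add mD mZ hA hB; apply: sub_decay_bounded.
apply: image_subset => _ [_ [u Au [v Bv <-]] <-].
by exists (u : G -> R); [exists u|exists (v : G -> R); [exists v|]].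
Qed.

Lemma decay_born_scale l A : decay_space_born A ->
  decay_space_born [set s *: u | s in [set s : R | `|s| <= l] & u in A].
Proof.
move=> hA; have := decay_bounded_scale mZ l hA; apply: sub_decay_bounded.
apply: image_subset => _ [_ [s sl [u Au <-]] <-].
by exists s => //; exists (u : G -> R); [exists u|].
Qed.

HB.instance Definition _ := isBornological.Build R decay_space
  decay_born_subset decay_born_finite decay_born_add decay_born_scale.

End DecaySpace.

Section FiniteSpaces.
Variables (R : realType) (G : groupType).

Lemma finsupp_lin (T : choiceType) (a : R) (f g : T -> R) :
  finite_set [set x | f x != 0] -> finite_set [set x | g x != 0] ->
  finite_set [set x | (a *: f + g) x != 0].
Proof.
move=> hf hg; apply: (@sub_finite_set _ _ ([set x | f x != 0] `|` [set x | g x != 0])).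
  move=> x /=; have [fx|] := eqVneq (f x) 0; last by left.
  have [gx|] := eqVneq (g x) 0; last by right.
  by rewrite -[(_ + _) x]/(a * f x + g x) fx gx mulr0 addr0 eqxx.
by rewrite finite_setU.
Qed.

Lemma finsupp0 (T : choiceType) : finite_set [set x : T | (0 : T -> R) x != 0].
Proof. by apply: (@sub_finite_set _ _ set0) => // x /=; rewrite eqxx. Qed.

Definition in_group_algebra : {pred G -> R} :=
  fun f => `[< finite_set [set x | f x != 0] >].

Lemma in_group_algebra_submod : submod_closed in_group_algebra.
Proof.
split=> [|a f g /asboolP hf /asboolP hg]; apply/asboolP; first exact: finsupp0.
exact: finsupp_lin.
Qed.

HB.instance Definition _ := GRing.isSubmodClosed.Build R (G -> R) in_group_algebra
  in_group_algebra_submod.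

Record group_algebra := GroupAlgebra {
  galg_val :> G -> R;
  galg_valP : galg_val \in in_group_algebra }.

HB.instance Definition _ := [isSub of group_algebra for galg_val].
HB.instance Definition _ := [Choice of group_algebra by <:].
HB.instance Definition _ := [SubChoice_isSubLmodule of group_algebra by <:].
HB.instance Definition _ := isBornological.Build R group_algebra
  (@fine_born_subset R group_algebra) (@fine_born_finite R group_algebra)
  (@fine_born_add R group_algebra) (@fine_born_scale R group_algebra).

(* (a * f)(x) = sum_g a(g) f(g^-1 x).  The sum is over the support of the
   summand, and is 0 by convention if that support is infinite; this never
   happens below, where a or f is finitely supported. *)
Definition convolution (T : choiceType) (act : G -> T -> T) (a : G -> R) (f : T -> R) : T -> R :=
  fun x => \sum_(g \in [set: G]) a g * f (act (g^-1)%g x).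

Definition gdelta (g : G) : G -> R := fun x => (x == g)%:R.

Lemma gdelta_in g : gdelta g \in in_group_algebra.
Proof.
apply/asboolP; apply: (@sub_finite_set _ _ [set g]); last exact: finite_set1.
by move=> x /=; rewrite /gdelta; case: (x =P g) => //; rewrite eqxx.
Qed.

Definition galg_delta g := GroupAlgebra (gdelta_in g).

Lemma convolution_in (a b : group_algebra) :
  convolution (fun g x => (g * x)%g) a b \in in_group_algebra.
Proof.
apply/asboolP.
have /asboolP fa := galg_valP a; have /asboolP fb := galg_valP b.
apply: sub_finite_set (finite_image2 (fun x y => (x * y)%g) fa fb).
move=> x; rewrite /= /convolution => xab.
have [g _] := fsbigN1 (f := fun x g => a g * b (g^-1 * x)%g) xab.
rewrite mulf_eq0 negb_or => /andP[ag bg].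
by exists g => //; exists (g^-1 * x)%g => //; rewrite mulVKg.
Qed.

Definition galg_mul (a b : group_algebra) : group_algebra := GroupAlgebra (convolution_in a b).

Definition galg_one := galg_delta 1%g.

End FiniteSpaces.

Section RightTranslation.
Variables (R : realType) (G : groupType) (S : generating_seq G) (t : decay R).

Lemma convolution_gdelta (f : G -> R) g x :
  convolution (fun g x => (g * x)%g) f (gdelta R g) x = f (x * g^-1)%g.
Proof.
rewrite /convolution -(@fsbig_widen _ _ _ _ [set x * g^-1]%g) //; last first.
  move=> h [_ /= hx]; rewrite /gdelta; case: eqP => [hg|_]; last by rewrite mulr0.
  by case: hx; rewrite -hg invgM invgK mulVKg.
by rewrite fsbig_set1 /gdelta invgM invgK mulgVK eqxx mulr1.
Qed.

Lemma decay_mulg_in (f : decay_space S t) g :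
  convolution (fun g x => (g * x)%g) f (gdelta R g) \in in_decay S t.
Proof.
apply/asboolP; have /asboolP := decay_valP f; apply: decay_bounded1 => w Ww.
have [C C0 hC] := weight_comp (word_length S g) Ww.
apply: (@norm_bounded_dom _ _ S w _ _ C) => // _ [_ -> <-].
exists (EFin \o f); first by exists (f : G -> R).
have gb : bijective (fun x => x * g)%g.
  by exists (fun x => x * g^-1)%g => x; rewrite ?mulgK ?mulgVK.
rewrite /weighted_norm (@reindex_esum _ _ _ setT setT (fun x => x * g)%g); last first.
  by rewrite setTT_bijective.
rewrite -esumZl // => [|x]; last by rewrite mule_ge0 ?lee_fin ?(weight_ge0 _ Ww).
apply: le_esum => x _; rewrite /= convolution_gdelta mulgK -!EFinM lee_fin.
by rewrite mulrCA ler_wpM2l // hC // /word_dist mulKg.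
Qed.

Definition decay_mulg (f : decay_space S t) (g : G) : decay_space S t :=
  DecaySpace (decay_mulg_in f g).

End RightTranslation.

Section Tuples.
Variable G : groupType.

Definition nondegenerate n (z : n.-tuple G) : bool := sorted (fun x y => x != y) z.

Definition face n (j : 'I_n.+1) (z : n.+1.-tuple G) : n.-tuple G :=
  [tuple tnth z (lift j i) | i < n].

Definition gact n (g : G) (z : n.-tuple G) : n.-tuple G := map_tuple (fun x => g * x)%g z.

Definition diameter_le (S : generating_seq G) (r n : nat) (z : n.-tuple G) : Prop :=
  forall i j, (word_dist S (tnth z i) (tnth z j) <= r)%N.

Definition tuple_insert n (j : 'I_n.+1) (y : n.-tuple G) (g : G) : n.+1.-tuple G :=
  [tuple if unlift j i is Some k then tnth y k else g | i < n.+1].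

Lemma insert_face n (j : 'I_n.+1) (z : n.+1.-tuple G) : tuple_insert j (face j z) (tnth z j) = z.
Proof.
apply: eq_from_tnth => i; rewrite tnth_mktuple.
by case: unliftP => [k ->|-> //]; rewrite tnth_mktuple.
Qed.

Lemma sorted_map_mulg (g : G) (s : seq G) :
  sorted (fun x y => x != y) (map (fun x => g * x)%g s) = sorted (fun x y => x != y) s.
Proof.
case: s => //= x s; elim: s x => //= y s IH x.
by rewrite IH (inj_eq (mulgI g)).
Qed.

Lemma nondegenerate_gact n g (z : n.-tuple G) : nondegenerate (gact g z) = nondegenerate z.
Proof. exact: sorted_map_mulg. Qed.

Lemma gactK n g : cancel (@gact n g) (gact (g^-1)%g).
Proof. by move=> z; apply: eq_from_tnth => i; rewrite !tnth_map mulKg. Qed.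

Lemma gactVK n g : cancel (@gact n (g^-1)%g) (gact g).
Proof. by move=> z; apply: eq_from_tnth => i; rewrite !tnth_map mulVKg. Qed.

End Tuples.

Section Boundary.
Variables (R : realType) (G : groupType).

(* The coefficient at y of sum_z f(z) sum_j (-1)^j (face j z), degenerate tuples
   being 0.  The inner sum has finite support in all uses below, see
   [chain_finite_fibers] and [decay_chain_finite_fibers]. *)
Definition boundary n (f : n.+2.-tuple G -> R) : n.+1.-tuple G -> R :=
  fun y => if nondegenerate y then
    \sum_(j < n.+2) (-1) ^+ j * (\sum_(z \in [set z | face j z = y]) f z)
  else 0.

Definition finite_fibers n (f : n.+2.-tuple G -> R) : Prop :=
  forall j y, finite_set [set z | face j z = y /\ f z != 0].

Lemma boundary_lin n a (f h : n.+2.-tuple G -> R) :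
  finite_fibers f -> finite_fibers h ->
  boundary (a *: f + h) = a *: boundary f + boundary h.
Proof.
move=> ff fh; apply/funext => y; rewrite -[RHS]/(a * boundary f y + boundary h y).
rewrite /boundary; case: ifP => _; last by rewrite mulr0 addr0.
rewrite mulr_sumr -big_split /=; apply: eq_bigr => j _.
rewrite mulrCA -mulrDr; congr (_ * _).
set F := [set z | face j z = y].
pose P := [set z | face j z = y /\ f z != 0] `|` [set z | face j z = y /\ h z != 0].
have PF : P `<=` F by move=> z [[]|[]].
have fP : finite_set P by rewrite finite_setU.
rewrite -!(@fsbig_widen _ _ _ _ P F) //.
- rewrite mulr_fsumr -fsbig_split //.
- move=> z [/= zF nP]; apply/eqP; apply: contra_notT nP => nz; right; split=> //.
- move=> z [/= zF nP]; apply/eqP; apply: contra_notT nP => nz; left; split=> //.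
move=> z [/= zF nP]; rewrite -[(_ + _) z]/(a * f z + h z).
have -> : f z = 0 by apply/eqP; apply: contra_notT nP => nz; left.
have -> : h z = 0 by apply/eqP; apply: contra_notT nP => nz; right.
by rewrite mulr0 addr0.
Qed.

Lemma boundary_neq0 n (f : n.+2.-tuple G -> R) y : boundary f y != 0 ->
  nondegenerate y /\ exists j z, face j z = y /\ f z != 0.
Proof.
rewrite /boundary; case: ifP => [ndy|]; last by rewrite eqxx.
move=> h; split=> //; apply: contrapT => H; move/eqP: h; apply.
apply: big1 => j _; rewrite fsbig1 ?mulr0 // => z zy.
by apply/eqP; apply: contra_notT H => nz; exists j, z.
Qed.

End Boundary.

Lemma exchange_big4 (R : nmodType) (I J K L : Type) (a : seq I) (b : seq J)
    (c : seq K) (d : seq L) (F : I -> J -> K -> L -> R) :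
  \sum_(i <- a) \sum_(j <- b) \sum_(k <- c) \sum_(l <- d) F i j k l =
  \sum_(l <- d) \sum_(k <- c) \sum_(j <- b) \sum_(i <- a) F i j k l.
Proof.
transitivity (\sum_(j <- b) \sum_(k <- c) \sum_(i <- a) \sum_(l <- d) F i j k l).
  by rewrite exchange_big /=; apply: eq_bigr => j _; rewrite exchange_big.
transitivity (\sum_(k <- c) \sum_(j <- b) \sum_(l <- d) \sum_(i <- a) F i j k l).
  rewrite exchange_big /=; apply: eq_bigr => k _; apply: eq_bigr => j _.
  by rewrite exchange_big.
rewrite [RHS]exchange_big /=; apply: eq_bigr => k _; by rewrite exchange_big.
Qed.

Section BoundaryBoundary.
Variables (R : realType) (G : groupType) (n : nat).

Lemma alternating_faces (F : n.+1.-tuple G -> R) (x : n.+3.-tuple G) :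
  \sum_(j < n.+3) \sum_(i < n.+2) (-1) ^+ (i + j) * F (face i (face j x)) = 0.
Proof.
rewrite pair_big /=.
pose h (p : 'I_n.+3 * 'I_n.+2) : 'I_n.+3 * 'I_n.+2 :=
  if (p.2 < p.1)%N then (inord p.2, inord p.1.-1) else (inord p.2.+1, inord p.1).
have h1 p : nat_of_ord (h p).1 = if (p.2 < p.1)%N then p.2 : nat else p.2.+1.
  case: p => j i; have := ltn_ord j; have := ltn_ord i => li lj.
  rewrite /h /=; case: (ltnP i j) => ij /=; rewrite inordK //; lia.
have h2 p : nat_of_ord (h p).2 = if (p.2 < p.1)%N then p.1.-1 else p.1 : nat.
  case: p => j i; have := ltn_ord j; have := ltn_ord i => li lj.
  rewrite /h /=; case: (ltnP i j) => ij /=; rewrite inordK //; lia.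
have hK : involutive h.
  move=> p; rewrite [LHS]surjective_pairing [RHS]surjective_pairing.
  by congr (_, _); apply: val_inj => /=; rewrite ?h1 ?h2 ?h1;
    case: p => j i /=; case: (ltnP i j) => ij; case: ifP => /=; lia.
set s := \sum_p _; suff : s = - s by move=> ss; lra.
rewrite {1}/s (reindex_inj (inv_inj hK)) /= -sumrN; apply: eq_bigr => p _.
have -> : face (h p).2 (face (h p).1 x) = face p.2 (face p.1 x).
  apply: eq_from_tnth => k; rewrite !tnth_mktuple; congr tnth; apply: val_inj.
  rewrite /= /bump h1 h2; case: p => j i /=.
  by case: (ltnP i j) => ij; lia.
rewrite -mulNr; congr (_ * _); rewrite h1 h2 -[in RHS]mulN1r -exprS.
rewrite -[LHS]signr_odd -[RHS]signr_odd; congr (_ ^+ (nat_of_bool _)).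
by case: p => j i /=; case: (ltnP i j) => ij; lia.
Qed.

Lemma alternating_degenerate (z : n.+2.-tuple G) (y : n.+1.-tuple G) :
  nondegenerate y -> ~~ nondegenerate z ->
  \sum_(i < n.+2) (-1) ^+ i * (face i z == y)%:R = 0 :> R.
Proof.
move=> ndy; pose x0 := thead z.
have ndP m (u : m.-tuple G) : nondegenerate u <->
    forall p : nat, (p.+1 < m)%N -> nth x0 u p != nth x0 u p.+1.
  split=> [/(sortedP x0) + p pm|H]; first by apply; rewrite size_tuple.
  by apply/(sortedP x0) => p; rewrite size_tuple => /H.
have nthF i p : (p < n.+1)%N -> nth x0 (face i z) p = nth x0 z (bump i p).
  move=> pn; rewrite -[p]/(nat_of_ord (Ordinal pn)) -tnth_nth tnth_mktuple.
  by rewrite (tnth_nth x0).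
move=> ndz; have [p [pn zp]] : exists p, (p.+1 < n.+2)%N /\ nth x0 z p = nth x0 z p.+1.
  apply: contrapT => H; move/negP: ndz; apply; apply/ndP => p pn.
  by apply/eqP => zp; apply: H; exists p.
have lp : (p < n.+2)%N by lia.
pose a : 'I_n.+2 := Ordinal lp; pose b : 'I_n.+2 := Ordinal pn.
have ab : b != a by rewrite -val_eqE /=; lia.
rewrite (bigD1 a) //= (bigD1 b) //= big1.
  have -> : face b z = face a z.
    apply: eq_from_tnth => k; rewrite !(tnth_nth x0) !nthF //= /bump.
    have [pk|pk] := leqP p.+1 k; first by rewrite (ltnW pk).
    have [kp|kp] := leqP p k => //.
    have -> : nat_of_ord k = p by lia.
    by rewrite add0n add1n zp.
  by rewrite exprS mulN1r mulNr addr0 addrN.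
move=> i /andP[ia ib]; case: eqP => [zy|_]; last by rewrite mulr0.
exfalso; have li := ltn_ord i; have /ndP ndy' := ndy.
move: ia ib; rewrite -!val_eqE /= => ia ib.
have [pi|ip] := ltnP p i.
  have := ndy' p; rewrite -zy !nthF; [|lia|lia].
  have -> : bump i p = p by rewrite /bump; lia.
  have -> : bump i p.+1 = p.+1 by rewrite /bump; lia.
  by rewrite zp eqxx => /(_ ltac:(lia)).
have := ndy' p.-1; rewrite -zy !nthF; [|lia|lia].
have -> : bump i p.-1 = p by rewrite /bump; lia.
have -> : bump i p.-1.+1 = p.+1 by rewrite /bump; lia.
by rewrite zp eqxx => /(_ ltac:(lia)).
Qed.

Lemma boundary_boundary (f : n.+3.-tuple G -> R) :
  (forall y : n.+1.-tuple G, finite_set [set x | f x != 0 /\ exists i j, face i (face j x) = y]) ->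
  boundary (boundary f) = 0.
Proof.
move=> ff; apply/funext => y; rewrite [LHS]/boundary; case: ifP => // ndy.
set P := [set x | f x != 0 /\ exists i j, face i (face j x) = y].
have [X uX PX] : exists2 X : seq (n.+3.-tuple G), uniq X & P = [set` X].
  have /finite_seqP[X0 PX0] := ff y; exists (undup X0); first exact: undup_uniq.
  by rewrite /P PX0; apply/seteqP; split=> x /=; rewrite mem_undup.
pose Z := undup [seq face j x | j <- enum 'I_n.+3, x <- X].
have toseq (T : choiceType) (s : seq T) (A : set T) (Q : pred T) (F : T -> R) :
    uniq s -> (forall x, A x <-> Q x) -> (forall x, A x -> F x != 0 -> x \in s) ->
    \sum_(x \in A) F x = \sum_(x <- s) (Q x)%:R * F x.
  move=> us AQ As; rewrite -(@fsbig_widen _ _ _ _ ([set` s] `&` A)) //.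
    rewrite fsbig_mkcondr -fsbig_seq //; apply: eq_bigr => x _.
    case: ifP => [|/negP]; rewrite inE => /AQ; first by move=> ->; rewrite mul1r.
    by move=> /negP/negbTE ->; rewrite mul0r.
  move=> x [/= Ax nsx]; apply/eqP; apply: contra_notT nsx => Fx; split=> //.
  exact: As.
pose E (z : n.+2.-tuple G) : R := (nondegenerate z)%:R *
  \sum_(j < n.+3) (-1) ^+ j * \sum_(x <- X) (face j x == z)%:R * f x.
have bE i z : face i z = y -> boundary f z = E z.
  move=> zy; rewrite /boundary /E; case: ifP => _; last by rewrite mul0r.
  rewrite mul1r; apply: eq_bigr => j _; congr (_ * _).
  apply: (toseq _ X); [exact: uX|by move=> x /=; split=> /eqP|move=> x /= xz fx].
  have : P x by split=> //; exists i, j; rewrite xz.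
  by rewrite PX.
have outer i : \sum_(z \in [set z | face i z = y]) boundary f z =
    \sum_(z <- Z) (face i z == y)%:R * E z.
  rewrite (eq_fsbigr E); last by move=> z /[!inE] /bE.
  apply: (toseq _ Z); [exact: undup_uniq|by move=> z; split=> /eqP|].
  move=> z zy; rewrite -(bE i) // => /boundary_neq0[_ [j [x [xz fx]]]].
  rewrite mem_undup -xz allpairs_f ?mem_enum //.
  have : P x by split=> //; exists i, j; rewrite xz.
  by rewrite PX.
under eq_bigr => i _ do rewrite outer.
transitivity (\sum_(x <- X) f x * \sum_(j < n.+3) \sum_(i < n.+2)
    (-1) ^+ (i + j) * (face i (face j x) == y)%:R); last first.
  apply: big1 => x _.
  by rewrite (alternating_faces (fun u => (u == y)%:R)) mulr0.
transitivity (\sum_(x <- X) f x * \sum_(j < n.+3) (-1) ^+ j * \sum_(z <- Z)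
    (face j x == z)%:R * ((nondegenerate z)%:R *
      \sum_(i < n.+2) (-1) ^+ i * (face i z == y)%:R)).
  transitivity (\sum_(i < n.+2) \sum_(z <- Z) \sum_(j < n.+3) \sum_(x <- X)
    (f x * ((-1) ^+ j * ((face j x == z)%:R * ((nondegenerate z)%:R *
      ((-1) ^+ i * (face i z == y)%:R)))))).
    apply: eq_bigr => i _; rewrite mulr_sumr; apply: eq_bigr => z _.
    rewrite /E !mulr_sumr; apply: eq_bigr => j _.
    by rewrite !mulr_sumr; apply: eq_bigr => x _; ring.
  rewrite exchange_big4; apply: eq_bigr => x _.
  rewrite mulr_sumr; apply: eq_bigr => j _; rewrite !mulr_sumr.
  by apply: eq_bigr => z _; rewrite !mulr_sumr; apply: eq_bigr => i _; ring.
apply: eq_big_seq => x xX; congr (_ * _); apply: eq_bigr => j _.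
have jZ : face j x \in Z by rewrite mem_undup allpairs_f ?mem_enum.
rewrite (bigD1_seq _ jZ (undup_uniq _)) /= eqxx mul1r [X in _ + X]big1 ?addr0; last first.
  by move=> z /negbTE; rewrite eq_sym => ->; rewrite mul0r.
have [nd|nd] := boolP (nondegenerate (face j x)).
  by rewrite mul1r mulr_sumr; apply: eq_bigr => i _; rewrite exprD; ring.
rewrite mul0r mulr0; under eq_bigr => i _ do rewrite exprD -mulrA mulrCA.
by rewrite -mulr_sumr alternating_degenerate ?mulr0.
Qed.
End BoundaryBoundary.

Section FiniteChains.
Variables (R : realType) (G : groupType) (n : nat).

Definition in_chain : {pred n.+1.-tuple G -> R} := fun f =>
  `[< finite_set [set z | f z != 0] /\ forall z, ~~ nondegenerate z -> f z = 0 >].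

Lemma in_chain_submod : submod_closed in_chain.
Proof.
split=> [|a f g /asboolP[hf df] /asboolP[hg dg]]; apply/asboolP.
  by split=> //; exact: finsupp0.
split; first exact: finsupp_lin.
by move=> z dz; rewrite -[LHS]/(a * f z + g z) df // dg // mulr0 addr0.
Qed.

HB.instance Definition _ := GRing.isSubmodClosed.Build R _ in_chain in_chain_submod.

Record chain := Chain {
  chain_val :> n.+1.-tuple G -> R;
  chain_valP : chain_val \in in_chain }.

HB.instance Definition _ := [isSub of chain for chain_val].
HB.instance Definition _ := [Choice of chain by <:].
HB.instance Definition _ := [SubChoice_isSubLmodule of chain by <:].
HB.instance Definition _ := isBornological.Build R chain
  (@fine_born_subset R chain) (@fine_born_finite R chain)
  (@fine_born_add R chain) (@fine_born_scale R chain).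

Lemma chain_gact_in (g : G) (f : chain) :
  (fun z => f (gact (g^-1)%g z)) \in in_chain.
Proof.
have /asboolP[ff df] := chain_valP f; apply/asboolP; split.
  apply: sub_finite_set (finite_image (gact g) ff) => z /= fz.
  by exists (gact (g^-1)%g z) => //; rewrite gactVK.
by move=> z dz; apply: df; rewrite nondegenerate_gact.
Qed.

Definition chain_gact (g : G) (f : chain) : chain := Chain (chain_gact_in g f).

End FiniteChains.

Section FiniteChainBoundary.
Variables (R : realType) (G : groupType) (n : nat).

Lemma chain_finite_fibers (f : chain R G n.+1) : finite_fibers f.
Proof.
by move=> j y; have /asboolP[ff _] := chain_valP f; apply: sub_finite_set ff => z /= [].
Qed.

Lemma chain_boundary_in (f : chain R G n.+1) : boundary f \in @in_chain R G n.
Proof.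
have /asboolP[ff _] := chain_valP f; apply/asboolP; split; last first.
  by move=> z /negbTE nz; rewrite /boundary nz.
have : finite_set (\bigcup_(j in [set: 'I_n.+2]) (face j @` [set z | f z != 0])).
  by apply: bigcup_finite => // j _; exact: finite_image.
apply: sub_finite_set => y /= /boundary_neq0[_ [j [z [<- fz]]]].
by exists j => //; exists z.
Qed.

Definition chain_boundary (f : chain R G n.+1) : chain R G n :=
  Chain (chain_boundary_in f).

Lemma chain_boundary_linear : linear chain_boundary.
Proof.
by move=> a f g; apply: val_inj; apply: boundary_lin; exact: chain_finite_fibers.
Qed.

HB.instance Definition _ := GRing.isLinear.Build R (chain R G n.+1) (chain R G n) _
  chain_boundary chain_boundary_linear.

Lemma chain_boundary_bounded : bounded_map chain_boundary.
Proof. exact: fine_born_linear. Qed.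

End FiniteChainBoundary.

Section DecayChains.
Variables (R : realType) (G : groupType) (S : generating_seq G) (t : decay R).

Definition marginal n (f : n.+1.-tuple G -> R) (x : G) : \bar R :=
  (\esum_(y in [set: n.-tuple G]) (`|f [tuple of x :: y]|)%:E)%E.

Definition chain_supported n (r : nat) (f : n.+1.-tuple G -> R) : Prop :=
  forall z, f z != 0 -> nondegenerate z /\ diameter_le S r z.

Lemma marginal_ge0 n f x : (0 <= @marginal n f x)%E.
Proof. by apply: esum_ge0 => y _; rewrite lee_fin. Qed.

Lemma marginalD n f g x :
  (`|@marginal n (f + g)%R x| <= `|marginal f x| + `|marginal g x|)%E.
Proof.
rewrite !gee0_abs ?marginal_ge0 // -esumD; [|by []|by []].
by apply: le_esum => y _; rewrite -EFinD lee_fin ler_normD.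
Qed.

Lemma marginalZ n a f x :
  (`|@marginal n (a *: f)%R x| <= `|a|%:E * `|marginal f x|)%E.
Proof.
rewrite !gee0_abs ?marginal_ge0 // -esumZl //.
by apply: le_esum => y _; rewrite -EFinM lee_fin normrM.
Qed.

Lemma weighted_norm_marginal n w (f : n.+1.-tuple G -> R) : is_weight S w ->
  weighted_norm w (marginal f) = (\esum_(z in [set: n.+1.-tuple G]) (`|f z| * w (thead z))%:E)%E.
Proof.
move=> Ww; rewrite /weighted_norm.
under eq_esum => x _ do rewrite gee0_abs ?marginal_ge0 // muleC -esumZl ?(weight_ge0 _ Ww) //.
rewrite esum_esum; last by move=> x y _ _; rewrite mule_ge0 ?lee_fin ?(weight_ge0 _ Ww).
rewrite [RHS](@reindex_esum _ _ _ ([set: G] `*`` (fun=> [set: n.-tuple G])) _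
  (fun k => [tuple of k.1 :: k.2])) //=.
  by apply: eq_esum => -[x y] _ /=; rewrite theadE EFinM muleC.
split=> //.
  by move=> [x y] [x' y'] _ _ /= /(congr1 val) /= [-> /val_inj ->].
by move=> z _; exists (thead z, [tuple of behead z]) => //=; rewrite -tuple_eta.
Qed.

Lemma norm_fsum_le (T : choiceType) (P : set T) (f : T -> R) :
  (`|\sum_(z \in P) f z|%:E <= \esum_(z in P) `|f z|%:E)%E.
Proof.
have [fin|inf] := pselect (finite_set (P `&` f @^-1` [set~ 0])); last first.
  by rewrite fsbig_dflt // normr0; apply: esum_ge0 => z _; rewrite lee_fin.
rewrite fsbig_supp fsbig_finite //=.
have h : (`|\sum_(z <- fset_set (P `&` f @^-1` [set~ 0%R])) f z|%R%:E <=
    (\sum_(z <- fset_set (P `&` f @^-1` [set~ 0%R])) `|f z|)%R%:E)%E.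
  by rewrite lee_fin ler_norm_sum.
apply: (le_trans h); rewrite -fsbig_finite // -fsumEFin //; apply: ereal_sup_ubound.
by exists (P `&` f @^-1` [set~ 0]) => //; split=> // z [].
Qed.

Lemma thead_face n (j : 'I_n.+2) (z : n.+2.-tuple G) :
  thead (face j z) = tnth z (lift j ord0).
Proof. by rewrite /thead tnth_mktuple. Qed.

Lemma weighted_norm_boundary n w (r : nat) : is_weight S w -> exists2 C : R, 0 <= C &
  forall f : n.+2.-tuple G -> R, chain_supported r f ->
    (weighted_norm w (marginal (boundary f)) <= C%:E * weighted_norm w (marginal f))%E.
Proof.
move=> Ww; have [C C0 hC] := weight_comp r Ww.
exists (n.+2%:R * C) => [|f hf]; first by rewrite mulr_ge0 ?ler0n.
have w0 x := weight_ge0 x Ww.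
rewrite !(weighted_norm_marginal _ Ww).
have step (j : 'I_n.+2) :
  (\esum_(y in [set: n.+1.-tuple G]) \esum_(z in [set z | face j z = y])
     ((`|f z| * w (thead y))%:E) <=
   C%:E * \esum_(z in [set: n.+2.-tuple G]) (`|f z| * w (thead z))%:E)%E.
  rewrite esum_esum; last by move=> *; rewrite lee_fin mulr_ge0.
  rewrite (@reindex_esum _ _ _ [set: n.+2.-tuple G] _ (fun z => (face j z, z))) /=; last first.
    split=> //; first by move=> z z' _ _ [].
    by move=> [y z] [_ /= <-]; exists z.
  rewrite -esumZl //; last by move=> z; rewrite lee_fin mulr_ge0.
  apply: le_esum => z _; rewrite -EFinM lee_fin thead_face mulrCA.
  have [->|/hf[_ dz]] := eqVneq (f z) 0; first by rewrite normr0 !mul0r.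
  by rewrite ler_wpM2l // hC // /thead dz.
apply: (@le_trans _ _ (\sum_(j < n.+2) \esum_(y in [set: n.+1.-tuple G])
    \esum_(z in [set z | face j z = y]) ((`|f z| * w (thead y))%:E))%E); last first.
  apply: (@le_trans _ _ (\sum_(j < n.+2) (C%:E * \esum_(z in [set: n.+2.-tuple G]) (`|f z| * w (thead z))%:E))%E).
    by apply: lee_sum => j _; exact: step.
  rewrite EFinM -muleA; set X := (C%:E * _)%E.
  rewrite sumr_const card_ord mule_natl; exact: lexx.
rewrite -esum_sum; last by move=> *; apply: esum_ge0 => *; rewrite lee_fin mulr_ge0.
apply: le_esum => y _.
have -> : (\sum_(j < n.+2) \esum_(z in [set z | face j z = y]) (`|f z| * w (thead y))%:E =
  (w (thead y))%:E * \sum_(j < n.+2) \esum_(z in [set z | face j z = y]) `|f z|%:E)%E.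
  rewrite ge0_sume_distrr; last by move=> j _; apply: esum_ge0 => *; rewrite lee_fin.
  apply: eq_bigr => j _; rewrite -esumZl //.
  by apply: eq_esum => z _; rewrite EFinM muleC.
rewrite EFinM muleC lee_wpmul2l ?lee_fin // /boundary; case: ifP => _; last first.
  by rewrite normr0; apply: sume_ge0 => j _; apply: esum_ge0 => *; rewrite lee_fin.
apply: (@le_trans _ _ (\sum_(j < n.+2) `|\sum_(z \in [set z | face j z = y]) f z|)%:E).
  rewrite lee_fin (le_trans (ler_norm_sum _ _ _)) //; apply: ler_sum => j _.
  by rewrite normrM normrX normrN1 expr1n mul1r.
by rewrite -sumEFin; apply: lee_sum => j _; exact: norm_fsum_le.
Qed.

Lemma boundary_supported n r (f : n.+2.-tuple G -> R) :
  chain_supported r f -> chain_supported r (boundary f).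
Proof.
move=> hf y /boundary_neq0[ndy [j [z [zy /hf[_ dz]]]]]; split=> //.
by move=> i k; rewrite -zy !tnth_mktuple.
Qed.

End DecayChains.

Section DecayChainSpace.
Variables (R : realType) (G : groupType) (S : generating_seq G) (t : decay R).
Variable n : nat.
Implicit Types (A B : set (n.+1.-tuple G -> R)).

(* A is contained and bounded in TC_n(X)_r for some r; as for [in_decay], f is in
   TC_n(X) iff its singleton is bounded. *)
Definition chain_bounded A : Prop :=
  exists2 r : nat, forall f, A f -> chain_supported S r f &
    decay_bounded S t [set marginal f | f in A].

Definition in_decay_chain : {pred n.+1.-tuple G -> R} :=
  fun f => `[< chain_bounded [set f] >].

Lemma chain_supported_lin a r s (f g : n.+1.-tuple G -> R) :
  chain_supported S r f -> chain_supported S s g ->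
  chain_supported S (maxn r s) (a *: f + g).
Proof.
move=> hf hg z; have [fz|/hf[dz hz] _] := eqVneq (f z) 0; last first.
  by split=> // i j; rewrite leq_max hz.
have [gz|/hg[dz hz] _] := eqVneq (g z) 0; last first.
  by split=> // i j; rewrite leq_max hz orbT.
by rewrite -[(_ + _) z]/(a * f z + g z) fz gz mulr0 addr0 eqxx.
Qed.

Lemma chain_supported0 r : chain_supported S r (0 : n.+1.-tuple G -> R).
Proof. by move=> z; rewrite eqxx. Qed.

Lemma chain_bounded_subset A B : A `<=` B -> chain_bounded B -> chain_bounded A.
Proof.
move=> AB [r hr hB]; exists r => [f /AB /hr //|].
by apply: sub_decay_bounded hB; exact: image_subset.
Qed.

Lemma chain_boundedU A B : chain_bounded A -> chain_bounded B ->
  chain_bounded (A `|` B).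
Proof.
move=> [r hr hA] [s hs hB]; exists (maxn r s).
  by move=> f [/hr|/hs] h z /h[dz hz]; split=> // i j; rewrite leq_max hz ?orbT.
by rewrite image_setU; exact: decay_boundedU.
Qed.

Lemma chain_bounded_finite A : finite_set A ->
  (forall f, A f -> chain_bounded [set f]) -> chain_bounded A.
Proof.
move=> /finite_seqP[s ->]; elim: s => [|f s IH] h.
  exists 0%N; first by move=> f; rewrite /= in_nil.
  apply: decay_boundedT => w _; exists 0 => f0 [f /= fs _]; by rewrite in_nil in fs.
apply: (@chain_bounded_subset _ ([set f] `|` [set` s])).
  by move=> g /=; rewrite inE => /orP[/eqP ->|]; [left|right].
apply: chain_boundedU; first by apply: h => /=; rewrite mem_head.
by apply: IH => g gs; apply: h; rewrite /= inE gs orbT.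
Qed.

Lemma chain_bounded_add A B : chain_bounded A -> chain_bounded B ->
  chain_bounded [set f + g | f in A & g in B].
Proof.
move=> [r hr hA] [s hs hB]; exists (maxn r s) => [_ [f Af [g Bg <-]]|].
  by rewrite -[f]scale1r; apply: chain_supported_lin; [exact: hr|exact: hs].
exact: (decay_bounded_add (@marginalD R G n) (@marginalZ R G n)).
Qed.

Lemma chain_bounded_scale l A : chain_bounded A ->
  chain_bounded [set s *: f | s in [set s : R | `|s| <= l] & f in A].
Proof.
move=> [r hr hA]; exists r => [_ [s _ [f Af <-]]|].
  rewrite -[s *: f]addr0 -[r]maxnn; apply: chain_supported_lin; first exact: hr.
  exact: chain_supported0.
exact: (decay_bounded_scale (@marginalZ R G n)).
Qed.

Lemma in_decay_chain_submod : submod_closed in_decay_chain.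
Proof.
split=> [|a f g /asboolP hf /asboolP hg]; apply/asboolP.
  exists 0%N; first by move=> _ ->; exact: chain_supported0.
  exact: (decay_bounded0 S t (@marginalZ R G n)).
have := chain_bounded_add (chain_bounded_scale `|a| hf) hg.
apply: chain_bounded_subset => _ ->; exists (a *: f); first by exists a => //=; exists f.
by exists g.
Qed.

HB.instance Definition _ :=
  GRing.isSubmodClosed.Build R _ in_decay_chain in_decay_chain_submod.

Record decay_chain := DecayChain {
  decay_chain_val :> n.+1.-tuple G -> R;
  decay_chain_valP : decay_chain_val \in in_decay_chain }.

HB.instance Definition _ := [isSub of decay_chain for decay_chain_val].
HB.instance Definition _ := [Choice of decay_chain by <:].
HB.instance Definition _ := [SubChoice_isSubLmodule of decay_chain by <:].

Definition decay_chain_born : set (set decay_chain) :=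
  [set A | chain_bounded [set decay_chain_val u | u in A]].

Lemma decay_chain_born_subset (A B : set decay_chain) :
  A `<=` B -> decay_chain_born B -> decay_chain_born A.
Proof. by move=> AB; apply: chain_bounded_subset; exact: image_subset. Qed.

Lemma decay_chain_born_finite (A : set decay_chain) :
  finite_set A -> decay_chain_born A.
Proof.
move=> fA; apply: chain_bounded_finite; first exact: finite_image.
by move=> _ [u Au <-]; exact/asboolP/(decay_chain_valP u).
Qed.

Lemma decay_chain_born_add (A B : set decay_chain) :
  decay_chain_born A -> decay_chain_born B ->
  decay_chain_born [set u + v | u in A & v in B].
Proof.
move=> hA hB; have := chain_bounded_add hA hB; apply: chain_bounded_subset.
move=> _ [_ [u Au [v Bv <-]] <-].
by exists (u : _ -> R); [exists u|exists (v : _ -> R); [exists v|]].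
Qed.

Lemma decay_chain_born_scale l (A : set decay_chain) : decay_chain_born A ->
  decay_chain_born [set s *: u | s in [set s : R | `|s| <= l] & u in A].
Proof.
move=> hA; have := chain_bounded_scale l hA; apply: chain_bounded_subset.
move=> _ [_ [s sl [u Au <-]] <-].
by exists s => //; exists (u : _ -> R); [exists u|].
Qed.

HB.instance Definition _ := isBornological.Build R decay_chain
  decay_chain_born_subset decay_chain_born_finite decay_chain_born_add
  decay_chain_born_scale.

End DecayChainSpace.

Section DecayChainBoundary.
Variables (R : realType) (G : groupType) (S : generating_seq G) (t : decay R).
Variable n : nat.

Lemma chain_bounded_boundary (A : set (n.+2.-tuple G -> R)) :
  chain_bounded S t A -> chain_bounded S t [set boundary f | f in A].
Proof.
move=> [r hr hA]; exists r => [_ [f /hr hf <-]|].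
  exact: boundary_supported.
apply: decay_bounded1 hA => w Ww; have [C C0 hC] := weighted_norm_boundary n r Ww.
apply: (@norm_bounded_dom _ _ S w _ _ C) => // _ [_ [f Af <-] <-].
by exists (marginal f); [exists f|exact/hC/hr].
Qed.

Lemma decay_chain_boundary_in (f : decay_chain S t n.+1) :
  boundary f \in @in_decay_chain R G S t n.
Proof.
apply/asboolP; have /asboolP := decay_chain_valP f.
by move=> /chain_bounded_boundary; rewrite image_set1.
Qed.

Definition decay_chain_boundary (f : decay_chain S t n.+1) : decay_chain S t n :=
  DecayChain (decay_chain_boundary_in f).

Lemma decay_chain_finite_fibers (f : decay_chain S t n.+1) : finite_fibers f.
Proof.
move=> j y; have /asboolP[r hr _] := decay_chain_valP f.
have {}hr : chain_supported S r f by exact: hr.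
have fB : finite_set [set tuple_insert j y (thead y * g)%g | g in
    [set g | (word_length S g <= r)%N]].
  by apply: finite_image; exact: finite_ball.
apply: sub_finite_set fB => z /= [<- /hr[_ dz]].
exists ((thead (face j z))^-1 * tnth z j)%g; last by rewrite mulVKg insert_face.
by rewrite /= thead_face; exact: dz.
Qed.

Lemma decay_chain_boundary_linear : linear decay_chain_boundary.
Proof.
by move=> a f g; apply: val_inj; apply: boundary_lin; exact: decay_chain_finite_fibers.
Qed.

HB.instance Definition _ := GRing.isLinear.Build R (decay_chain S t n.+1)
  (decay_chain S t n) _ decay_chain_boundary decay_chain_boundary_linear.

Lemma decay_chain_boundary_bounded : bounded_map decay_chain_boundary.
Proof.
move=> A /chain_bounded_boundary; apply: chain_bounded_subset.
by move=> _ [_ [f Af <-] <-]; exists (f : _ -> R) => //; exists f.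
Qed.

End DecayChainBoundary.

Lemma chain_boundary_boundary (R : realType) (G : groupType) n
    (f : chain R G n.+2) : chain_boundary (chain_boundary f) = 0.
Proof.
apply: val_inj; apply: boundary_boundary => y.
by have /asboolP[ff _] := chain_valP f; apply: sub_finite_set ff => x [].
Qed.

Lemma decay_chain_boundary_boundary (R : realType) (G : groupType)
    (S : generating_seq G) (t : decay R) n (f : decay_chain S t n.+2) :
  decay_chain_boundary (decay_chain_boundary f) = 0.
Proof.
apply: val_inj; apply: boundary_boundary => y.
have /asboolP[r hr _] := decay_chain_valP f.
have {}hr : chain_supported S r f by exact: hr.
pose B := [set (thead y * g)%g | g in [set g | (word_length S g <= r)%N]].
have fB : finite_set B by apply: finite_image; exact: finite_ball.
have : finite_set (\bigcup_(ij in [set: 'I_n.+2 * 'I_n.+3])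
    [set tuple_insert ij.2 (tuple_insert ij.1 y g) h | g in B & h in B]).
  by apply: bigcup_finite => // ij _; exact: finite_image2.
apply: sub_finite_set => x /= [/hr[_ dx] [i [j xy]]].
have yx : thead y = tnth x (lift j (lift i ord0)).
  by rewrite -xy thead_face tnth_mktuple.
exists (i, j) => //=; exists (tnth (face j x) i).
  exists ((thead y)^-1 * tnth (face j x) i)%g; last by rewrite mulVKg.
  by rewrite /= yx tnth_mktuple; exact: dx.
exists (tnth x j); last by rewrite -xy !insert_face.
by exists ((thead y)^-1 * tnth x j)%g; [rewrite /= yx; exact: dx|rewrite mulVKg].
Qed.

Section Complexes.
Variable R : realType.

Record born_complex := BornComplex {
  cx_obj :> nat -> bornType R;
  cx_d : forall n, {linear cx_obj n.+1 -> cx_obj n};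
  cx_d_bounded : forall n, bounded_map (cx_d n);
  cx_dd : forall n x, cx_d n (cx_d n.+1 x) = 0 }.

Definition chain_map (X Y : born_complex) (f : forall n, {linear X n -> Y n}) :
    Prop :=
  (forall n, bounded_map (f n)) /\
  forall n x, f n (cx_d X n x) = cx_d Y n (f n.+1 x).

Definition chain_iso (X Y : born_complex) (f : forall n, {linear X n -> Y n}) :
    Prop :=
  chain_map f /\
  exists2 g : forall n, {linear Y n -> X n}, chain_map g &
    forall n, cancel (f n) (g n) /\ cancel (g n) (f n).

(* u is homotopic to the identity, through bounded linear maps. *)
Definition homotopic_id (X : born_complex) (u : forall n, X n -> X n) : Prop :=
  exists h : forall n, {linear X n -> X n.+1},
    [/\ forall n, bounded_map (h n),
        forall x, u 0 x - x = cx_d X 0 (h 0 x) &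
        forall n x, u n.+1 x - x =
          cx_d X n.+1 (h n.+1 x) + h n (cx_d X n x)].

Definition homotopy_equivalent (X Y : born_complex) : Prop :=
  exists (f : forall n, {linear X n -> Y n}) (g : forall n, {linear Y n -> X n}),
    [/\ chain_map f, chain_map g,
        homotopic_id (fun n => g n \o f n) &
        homotopic_id (fun n => f n \o g n)].

End Complexes.

Definition chain_complex (R : realType) (G : groupType) : born_complex R :=
  BornComplex (@chain_boundary_bounded R G) (@chain_boundary_boundary R G).

Definition decay_chain_complex (R : realType) (G : groupType)
    (S : generating_seq G) (t : decay R) : born_complex R :=
  BornComplex (@decay_chain_boundary_bounded R G S t)
    (@decay_chain_boundary_boundary R G S t).

Section FreeResolutions.
Variables (R : realType) (G : groupType).
Local Notation RG := (group_algebra R G).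

Definition is_module_action (M : bornType R) (act : {bilinear RG -> M -> M}) : Prop :=
  [/\ bounded_map2 act, forall m, act (galg_one R G) m = m &
      forall a b m, act (galg_mul a b) m = act a (act b m)].

Definition is_free_module (M : cbornType R) (act : {bilinear RG -> M -> M}) : Prop :=
  exists (V : cbornType R) (tens : {bilinear RG -> V -> M}),
    is_ctensor tens /\
    forall a b v, act a (tens b v) = tens (galg_mul a b) v.

(* a acts on the trivial module R by multiplication by [galg_aug a]. *)
Definition galg_aug (a : RG) : R := \sum_(g \in [set: G]) a g.

Record free_resolution := FreeResolution {
  res_obj : nat -> cbornType R;
  res_act : forall n, {bilinear RG -> res_obj n -> res_obj n};
  res_actP : forall n, is_module_action (res_act n);
  res_free : forall n, is_free_module (res_act n);
  res_d : forall n, {linear res_obj n.+1 -> res_obj n};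
  res_d_bounded : forall n, bounded_map (res_d n);
  res_d_act : forall n a x, res_d n (res_act n.+1 a x) = res_act n a (res_d n x);
  res_dd : forall n x, res_d n (res_d n.+1 x) = 0;
  res_aug : {linear res_obj 0 -> R^o};
  res_aug_bounded : bounded_map res_aug;
  res_aug_act : forall a x, res_aug (res_act 0 a x) = galg_aug a * res_aug x;
  res_aug_d : forall x, res_aug (res_d 0 x) = 0;
  res_contractible :
    exists (s : {linear R^o -> res_obj 0})
           (h : forall n, {linear res_obj n -> res_obj n.+1}),
      [/\ bounded_map s /\ forall n, bounded_map (h n),
          forall c, res_aug (s c) = c,
          forall x, s (res_aug x) + res_d 0 (h 0 x) = x &
          forall n x, h n (res_d n x) + res_d n.+1 (h n.+1 x) = x] }.

Definition res_complex (P : free_resolution) : born_complex R :=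
  BornComplex (@res_d_bounded P) (@res_dd P).

Definition res_gact (P : free_resolution) (n : nat) (g : G) :
    res_complex P n -> res_complex P n :=
  res_act P n (galg_delta R g).

End FreeResolutions.

Section BalancedTensor.
Variables (R : realType) (G : groupType) (S : generating_seq G) (t : decay R).
Local Notation TG := (decay_space S t).

Definition balancing_relations (M : bornType R) (act : G -> M -> M)
    (W : bornType R) (tens : TG -> M -> W) : set W :=
  [set x | exists phi g m, x = tens (decay_mulg phi g) m - tens phi (act g m)].

(* [bt_obj] is T(G) (x)_G M: the quotient of a completed tensor product of T(G)
   and M by the closed linear span of the balancing relations.  The universal
   property determines it up to unique isomorphism. *)
Record balanced_tensor (M : bornType R) (act : G -> M -> M) := BalancedTensor {
  bt_ctensor : cbornType R;
  bt_tens : {bilinear TG -> M -> bt_ctensor};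
  bt_tensP : is_ctensor bt_tens;
  bt_obj :> cbornType R;
  bt_proj : {linear bt_ctensor -> bt_obj};
  bt_projP : is_quotient (closed_span (balancing_relations act bt_tens)) bt_proj }.

Definition bt_class (M : bornType R) (act : G -> M -> M)
    (Q : balanced_tensor act) (phi : TG) (m : M) : Q :=
  bt_proj Q (bt_tens Q phi m).

(* T(G) (x)_G C for a complex C of G-modules; the boundary map is induced by
   that of C. *)
Record balanced_complex (C : born_complex R) (act : forall n, G -> C n -> C n) :=
  BalancedComplex {
    bc_obj :> forall n, balanced_tensor (act n);
    bc_d : forall n, {linear bc_obj n.+1 -> bc_obj n};
    bc_d_bounded : forall n, bounded_map (bc_d n);
    bc_dE : forall n phi m,
      bc_d n (bt_class (bc_obj n.+1) phi m) =
      bt_class (bc_obj n) phi (cx_d C n m) }.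

Lemma bt_class_eq0 (M : bornType R) (act : G -> M -> M)
    (Q : balanced_tensor act) (E : cbornType R) (f : {linear Q -> E}) :
  bounded_map f -> (forall phi m, f (bt_class Q phi m) = 0) -> forall x, f x = 0.
Proof.
move=> bf f0 x; have [sq kq bq] := bt_projP Q; have [y <-] := sq x.
have bp : bounded_map (bt_proj Q) by move=> A hA; apply/bq; exists A.
apply: (ctensor_eq (bt_tensP Q) (f := f \o bt_proj Q) (f' := \0)) => //.
  by move=> A /bp /bf; rewrite image_comp.
move=> A _; apply: born_subset (born_finite _ (finite_set1 0)).
by move=> _ [z _ <-].
Qed.

Lemma bc_dd (C : born_complex R) (act : forall n, G -> C n -> C n)
    (Q : balanced_complex act) n (x : Q n.+2) : bc_d Q n (bc_d Q n.+1 x) = 0.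
Proof.
apply: (bt_class_eq0 (f := bc_d Q n \o bc_d Q n.+1)) => [A /bc_d_bounded|phi m].
  by move=> /bc_d_bounded; rewrite image_comp.
by rewrite /= !bc_dE cx_dd /bt_class !linear0r linear0.
Qed.

Definition bc_complex (C : born_complex R) (act : forall n, G -> C n -> C n)
    (Q : balanced_complex act) : born_complex R :=
  BornComplex (@bc_d_bounded C act Q) (@bc_dd C act Q).

End BalancedTensor.

(* Main.v *)
(* Write T for the convolution algebra. The universal property of T (x)_G C_n is
   verified directly for TC_n: a chain f of TC_n is supported on tuples of
   diameter at most r, so it is a finite sum, over normalised tuples (1, y), of
   its slices x |-> f(x, xy) in T convolved with (1, y). Hence a balanced bounded
   bilinear map b on T x C_n extends to TC_n by f |-> sum_y b(f_y, (1, y)). For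
   this TC_n and C_n must be complete, which holds because each bounded set lies
   in the unit ball of a supremum of finitely supported weighted l^1 seminorms,
   and such a ball spans a Banach space. Finally C_n(G) and any free resolution
   P_n consist of relatively projective modules and are contractible over R, so
   they are G-equivariantly homotopy equivalent, and the balanced tensor product
   with T preserves homotopy equivalences. *)

From HB Require Import structures.
From mathcomp Require Import all_boot all_order all_algebra.
From mathcomp Require Import zify ring finmap.
From mathcomp Require Import all_classical all_reals all_analysis.
From mathcomp Require Import sesquilinear.
(* After sesquilinear, whose [nondegenerate] would otherwise shadow that of Defs. *)
Require Import Defs.

Set Implicit Arguments.
Unset Strict Implicit.
Unset Printing Implicit Defensive.
Import Order.TTheory GRing.Theory Num.Theory.
Import numFieldNormedType.Exports.
Local Open Scope classical_set_scope.
Local Open Scope ring_scope.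

(** * Completeness of bornologies given by weighted seminorms *)

(** The product T (x)_G M is known only through its universal property among complete spaces, so two
    universal objects are compared, with [is_balanced_tensor] as their common interface. This is why
    completeness has to be established for everything that serves as a target: TC_n, C_n and the
    trivial module R. Identities between bounded maps are then checked on elementary tensors.

    Boundedness of the extension to TC_n rests on the finiteness of balls in the word metric: tuples
    (1, y) of diameter at most r have all entries in one finite ball, and a single r serves a whole
    bounded set.

    The contracting homotopy of a resolution is bounded but not equivariant. It becomes usable
    through the correction x |-> g s(g^-1 x), where g moves a representative of the orbit to x;
    relative projectivity records exactly what this correction achieves. The slices of TC_n use the
    same orbit representatives, the tuples starting with 1. *)

Section BanachDisk.
Variables (R : realType) (X : choiceType).

(** An entry of [d] is a point with its coefficient. Finite sums are continuous for pointwise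
    convergence; a weighted l^1 norm is recovered as a supremum over lists. *)
Definition finite_weight (d : seq (X * R)) (f : X -> R) : R :=
  \sum_(q <- d) `|q.2 * f q.1|.

Lemma finite_weight_ge0 d f : 0 <= finite_weight d f.
Proof. exact: sumr_ge0. Qed.

Lemma finite_weightD d f g :
  finite_weight d (f + g) <= finite_weight d f + finite_weight d g.
Proof.
rewrite /finite_weight -big_split /=; apply: ler_sum => q _.
by rewrite -[(f + g) _]/(f q.1 + g q.1) mulrDr ler_normD.
Qed.

Lemma finite_weightZ d a f : finite_weight d (a *: f) = `|a| * finite_weight d f.
Proof.
rewrite /finite_weight mulr_sumr; apply: eq_bigr => q _.
by rewrite -[(a *: f) _]/(a * f q.1) mulrCA normrM.
Qed.

Lemma finite_weight_le d f (q : X * R) :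
  q \in d -> `|q.2 * f q.1| <= finite_weight d f.
Proof.
move=> qd; rewrite /finite_weight (big_rem q) //=.
by rewrite lerDl sumr_ge0.
Qed.

(** [disk_cover] makes the gauge definite and the evaluations continuous; [disk_nil] makes the set
    in the supremum nonempty and the gauge nonnegative. *)
Record disk_family := DiskFamily {
  disk_weights :> set (seq (X * R));
  disk_nil : disk_weights [::];
  disk_cover : forall x, exists2 d, disk_weights d &
    exists2 c : R, c != 0 & (x, c) \in d }.

Variable D : disk_family.

Definition in_disk (r : R) (f : X -> R) : Prop :=
  forall d, disk_weights D d -> finite_weight d f <= r.

(** The linear span of the unit disk; [disk_norm] below is the gauge of that disk. *)
Definition disk_pred : {pred X -> R} := fun f => `[< exists r, in_disk r f >].

Lemma disk_submod : submod_closed disk_pred.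
Proof.
split=> [|a f g /asboolP[r hr] /asboolP[s hs]]; apply/asboolP.
  exists 0 => d _; rewrite -(scale0r 0) finite_weightZ.
  by rewrite normr0 mul0r.
exists (`|a| * r + s) => d Dd; apply: le_trans (finite_weightD _ _ _) _.
by rewrite finite_weightZ lerD ?ler_wpM2l ?hr ?hs.
Qed.

HB.instance Definition _ :=
  GRing.isSubmodClosed.Build R _ disk_pred disk_submod.

Record disk_space := DiskSpace {
  disk_val :> X -> R;
  disk_valP : disk_val \in disk_pred }.

HB.instance Definition _ := [isSub of disk_space for disk_val].
HB.instance Definition _ := [Choice of disk_space by <:].
HB.instance Definition _ := [SubChoice_isSubLmodule of disk_space by <:].

Definition disk_norm (f : disk_space) : R :=
  sup [set finite_weight d f | d in disk_weights D].

Lemma disk_norm_ubound (f : disk_space) :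
  has_sup [set finite_weight d f | d in disk_weights D].
Proof.
split; first by exists (finite_weight [::] f), [::] => //; exact: disk_nil.
have /asboolP[r hr] := disk_valP f.
by exists r => _ [d Dd <-]; exact: hr.
Qed.

Lemma disk_norm_le (f : disk_space) r : (disk_norm f <= r) <-> in_disk r f.
Proof.
split=> [h d Dd|h].
  apply: le_trans h; apply: sup_upper_bound; first exact: disk_norm_ubound.
  by exists d.
apply: ge_sup; first by have [] := disk_norm_ubound f.
by move=> _ [d Dd <-]; exact: h.
Qed.

Lemma finite_weight_norm (f : disk_space) d : disk_weights D d -> finite_weight d f <= disk_norm f.
Proof. by have /disk_norm_le := lexx (disk_norm f); apply. Qed.

Lemma disk_norm_ge0 f : 0 <= disk_norm f.
Proof. by apply: le_trans (finite_weight_norm f (disk_nil D)); exact: finite_weight_ge0. Qed.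

Lemma disk_normD f g : disk_norm (f + g) <= disk_norm f + disk_norm g.
Proof.
apply/disk_norm_le => d Dd; apply: le_trans (finite_weightD _ _ _) _.
by rewrite lerD ?finite_weight_norm.
Qed.

Lemma disk_normZ a f : disk_norm (a *: f) = `|a| * disk_norm f.
Proof.
have le b g : disk_norm (b *: g) <= `|b| * disk_norm g.
  by apply/disk_norm_le => d Dd; rewrite finite_weightZ ler_wpM2l ?finite_weight_norm.
apply/eqP; rewrite eq_le le /=; have [->|a0] := eqVneq a 0.
  by rewrite normr0 mul0r disk_norm_ge0.
have := le (a^-1) (a *: f); rewrite scalerA mulVf // scale1r.
by rewrite normfV ler_pdivlMl ?normr_gt0.
Qed.

Lemma disk_eval x : exists2 C : R, 0 <= C & forall f : disk_space, `|f x| <= C * disk_norm f.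
Proof.
have [d Dd [c c0 xd]] := disk_cover D x; exists `|c|^-1; first by rewrite invr_ge0.
move=> f; rewrite ler_pdivlMl ?normr_gt0 // -normrM.
exact: le_trans (finite_weight_le f xd) (finite_weight_norm f Dd).
Qed.

Lemma disk_norm0 f : disk_norm f = 0 -> f = 0.
Proof.
move=> f0; apply: val_inj; apply/funext => x /=.
have [C C0 /(_ f)] := disk_eval x; rewrite f0 mulr0 normr_le0 => /eqP //.
Qed.

HB.instance Definition _ := Lmodule_isNormed.Build R disk_space
  disk_normD disk_normZ disk_norm0.

(** A Cauchy filter converges pointwise because evaluations are continuous. Each finite seminorm
    passes to the pointwise limit, so the Cauchy estimates survive in the supremum and give
    convergence in norm. *)
Lemma disk_complete (F : set_system disk_space) :
  ProperFilter F -> cauchy F -> cvg F.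
Proof.
move=> FF cF.
have evc x : cvg ((fun f : disk_space => f x) @ F).
  apply: cauchy_cvg; apply/cauchy_ballP => e e0.
  have [C C0 hC] := disk_eval x.
  (* The [+ 1] keeps the divisor positive when [C] is 0. *)
  have /cauchy_ballP /(_ (e / (C + 1))) := cF; case.
    by rewrite divr_gt0 // ltr_wpDl.
  move=> [A A'] [/= FA FA'] h; exists ([set f x | f in A], [set f x | f in A']).
    by split; rewrite /= /nbhs /=; [apply: filterS FA|apply: filterS FA'] => f Af; exists f.
  move=> [u v] [/= [f Af <-] [g Ag <-]].
  have := h (f, g) (conj Af Ag); rewrite /= -!ball_normE /= => fg.
  rewrite -[f x - g x]/((f - g) x); apply: le_lt_trans (hC _) _.
  apply: (@le_lt_trans _ _ ((C + 1) * disk_norm (f - g))).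
    by rewrite ler_wpM2r ?disk_norm_ge0 // lerDl.
  by rewrite mulrC -ltr_pdivlMr // ltr_wpDl.
pose l : X -> R := fun x => lim ((fun f : disk_space => f x) @ F).
have close e : 0 < e -> \forall f \near F, in_disk e (disk_val f - l).
  move=> e0; have /cauchyP /(_ (e / 2)) := cF.
  case=> [|f0 Ff0]; first by rewrite divr_gt0.
  apply: filterS (Ff0) => f ff0 d Dd.
  have cv : (fun g : disk_space => finite_weight d (disk_val f - disk_val g)) @ F -->
      finite_weight d (disk_val f - l).
    rewrite /finite_weight; apply: cvg_big => [|q _]; first exact: add_continuous.
    apply: cvg_norm.
    apply: cvgM; first exact: cvg_cst.
    by apply: cvgB; [exact: cvg_cst|exact: evc].
  apply: (closed_cvg (fun x : R => x <= e)) cv; first exact: closed_le.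
  apply: filterS (Ff0) => g gf0.
  move: ff0 gf0; rewrite -!ball_normE /= => ff0 gf0.
  apply: le_trans (finite_weight_norm (f - g) Dd) _; apply: ltW.
  rewrite [e]splitr -[disk_norm _]/`|f - g|.
  by rewrite (le_lt_trans (ler_distD f0 _ _)) // ltrD // distrC.
have lD : l \in disk_pred.
  have [f fl] := filter_ex (close 1 ltr01); have /asboolP[r hr] := disk_valP f.
  apply/asboolP; exists (r + 1) => d Dd.
  have -> : l = disk_val f + (- 1) *: (disk_val f - l).
    by rewrite scaleN1r opprB addrC subrK.
  by rewrite (le_trans (finite_weightD _ _ _)) // lerD ?hr // finite_weightZ
    normrN1 mul1r fl.
apply/cvg_ex; exists (DiskSpace lD); apply/cvgrPdist_le => e e0.
apply: filterS (close e e0) => f fe; rewrite distrC.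
by apply/disk_norm_le.
Qed.

HB.instance Definition _ := Uniform_isComplete.Build disk_space disk_complete.

End BanachDisk.

(** The space V_T is the disk space itself. Its inclusion into V inverts [ev]: the last condition
    supplies preimages, and injectivity of [ev] makes their choice linear. *)
Lemma born_complete_of_disks (R : realType) (X : choiceType) (V : bornType R)
    (ev : {linear V -> (X -> R)}) :
  injective ev ->
  (forall A : set V, born A -> exists D : disk_family R X,
    [/\ forall v, A v -> in_disk D 1 (ev v),
        forall r, born [set v | in_disk D r (ev v)] &
        forall r f, in_disk D r f -> exists v, ev v = f]) ->
  forall A : set V, born A ->
    exists (B : completeNormedModType R) (i : {linear B -> V}),
      [/\ injective i,
          forall r : R, born (i @` [set x : B | `|x| <= r]) &
          exists r : R, A `<=` i @` [set x : B | `|x| <= r]].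
Proof.
move=> ev_inj H A /H[D [AD bD fD]].
have ex (b : disk_space D) : exists v, ev v = b.
  by have /asboolP[r /fD] := disk_valP b.
have [i iE] := choice ex.
have li : linear i.
  by move=> a b b'; apply: ev_inj; rewrite linearP !iE.
pose iL := GRing.isLinear.Build R (disk_space D) V _ i li.
pose I : {linear disk_space D -> V} := HB.pack i iL.
exists (disk_space D), I; split.
- by move=> b b' /= bb; apply: val_inj; rewrite -[LHS]iE -[RHS]iE bb.
- move=> r; apply: born_subset (bD r) => _ [b /= br <-].
  by rewrite iE; exact/disk_norm_le.
exists 1 => v /AD vD; have vP : ev v \in disk_pred D by apply/asboolP; exists 1.
exists (DiskSpace vP); first exact/disk_norm_le.
by apply: ev_inj; rewrite iE.
Qed.

(** Needed because the augmentation, with values in [R^o], is one of the maps [p] against which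
    relative projectivity is applied. *)
Lemma real_born_complete (R : realType) (A : set R^o) : born A ->
    exists (B : completeNormedModType R) (i : {linear B -> R^o}),
      [/\ injective i,
          forall r : R, born (i @` [set x : B | `|x| <= r]) &
          exists r : R, A `<=` i @` [set x : B | `|x| <= r]].
Proof.
move=> [n [b [C hA]]]; exists R^o, idfun; split=> // [r|].
  exists 1%N, (fun=> 1), r => _ [x /= xr <-].
  by exists (fun=> x) => //; rewrite big_ord1 -[RHS]/(x * 1) mulr1.
exists (\sum_i C * `|b i|) => x /hA[c cC ->].
exists (\sum_i c i *: b i) => //=; apply: le_trans (ler_norm_sum _ _ _) _.
by apply: ler_sum => i _; rewrite normrM ler_wpM2r.
Qed.

HB.instance Definition _ (R : realType) :=
  isCompleteBornological.Build R R^o (@real_born_complete R).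

(** Translates bounds on extended real sums into bounds on duplicate-free lists, the form in which
    disks are described. *)
Lemma ge0_esum_leP (R : realType) (T : choiceType) (a : T -> R) (M : R) :
  (forall x, 0 <= a x) ->
  (\esum_(x in [set: T]) (a x)%:E <= M%:E)%E <->
  (forall s, uniq s -> \sum_(x <- s) a x <= M).
Proof.
move=> a0; split=> [h s us|h].
  rewrite -lee_fin; apply: le_trans h; apply: ereal_sup_ubound.
  by exists [set` s] => //; rewrite -fsbig_seq // sumEFin.
apply: ge_ereal_sup => _ [Y [fY _] <-]; rewrite fsbig_finite //= sumEFin lee_fin.
exact/h/fset_uniq.
Qed.

Section WeightFamilies.
Variables (R : realType) (G : groupType) (S : generating_seq G).

Lemma weight_gt0 w x : is_weight S w -> 0 < w x :> R.
Proof.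
case=> [k k0|a a1]; first by rewrite powR_gt0 // ltr0n.
by rewrite exprn_gt0 // (lt_trans ltr01).
Qed.

(** Each weight is paired with a bound valid on [F]. All weights of the algebra are kept, except for
    [DecayExp], where boundedness is existential and one base [a] that works for [F] is fixed. The
    last clause says that the multiples of the resulting disk are again bounded. *)
Lemma decay_bounded_family (t : decay R) (F : set (G -> \bar R)) :
  decay_bounded S t F -> exists W : set ((G -> R) * R),
  [/\ W !=set0,
      forall q, W q -> is_weight S q.1 /\ 0 < q.2,
      forall q f, W q -> F f -> (weighted_norm q.1 f <= q.2%:E)%E &
      forall r : R, decay_bounded S t
        [set f | forall q, W q -> (weighted_norm q.1 f <= (r * q.2)%:E)%E]].
Proof.
pose good w : set ((G -> R) * R) := [set q | [/\ q.1 = w, 0 < q.2 &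
   forall f, F f -> (weighted_norm q.1 f <= q.2%:E)%E]].
have ne w : norm_bounded w F -> exists q, good w q.
  (* The maximum with 1 makes the bound positive, since it is used as a divisor later. *)
  move=> [C hC]; exists (w, Num.max C 1); split=> //=.
    by rewrite lt_max ltr01 orbT.
  by move=> f /hC /le_trans; apply; rewrite lee_fin le_max lexx.
have nb w r : norm_bounded w F -> norm_bounded w
    [set f | forall q, good w q -> (weighted_norm q.1 f <= (r * q.2)%:E)%E].
  by move=> /ne[q gq]; exists (r * q.2) => f /(_ _ gq); case: gq => ->.
case: t => [k| | |] /=.
- move=> h; exists (good (poly_weight S k%:num)); split.
  + exact: ne.
  + by move=> q [-> q0 _]; split=> //; constructor.
  + by move=> q f [_ _]; apply.
  + by move=> r; exact: nb.
- move=> h; exists (\bigcup_(k in [set: nat]) good (poly_weight S k%:R)); split.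
  + by have [q gq] := ne _ (h 0%N); exists q, 0%N.
  + by move=> q [k _ [-> q0 _]]; split=> //; constructor.
  + by move=> q f [k _ [_ _]]; apply.
  + move=> r k; have [C hC] := nb _ r (h k); exists C => f hf; apply: hC => q gq.
    by apply: hf; exists k.
- move=> h; exists (\bigcup_(a in [set a | 1 < a]) good (exp_weight S a)); split.
  + have l2 : 1 < 2 :> R by rewrite ltr1n.
    by have [q gq] := ne _ (h 2 l2); exists q, 2.
  + by move=> q [a a1 [-> q0 _]]; split=> //; constructor.
  + by move=> q f [a _ [_ _]]; apply.
  + move=> r a a1; have [C hC] := nb _ r (h a a1); exists C => f hf; apply: hC => q gq.
    by apply: hf; exists a.
- move=> [a a1 h]; exists (good (exp_weight S a)); split.
  + exact: ne.
  + by move=> q [-> q0 _]; split=> //; constructor.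
  + by move=> q f [_ _]; apply.
  + by move=> r; exists a => //; exact: nb.
Qed.

End WeightFamilies.

(** * Completeness of the decay chain spaces *)

Section ChainsComplete.
Variables (R : realType) (G : groupType) (S : generating_seq G) (t : decay R).
Variable n : nat.

(** Two kinds of lists define the disk. Those in [D1] are partial sums of the weighted norms of the
    marginal, divided by their bounds on [A]; by [weighted_norm_marginal] the weight of a tuple is
    that of its first entry. Those in [D2] enforce the support condition. *)
Lemma decay_chain_complete (A : set (decay_chain S t n)) : born A ->
    exists (B : completeNormedModType R) (i : {linear B -> decay_chain S t n}),
      [/\ injective i,
          forall r : R, born (i @` [set x : B | `|x| <= r]) &
          exists r : R, A `<=` i @` [set x : B | `|x| <= r]].
Proof.
have H := @born_complete_of_disks R _ (decay_chain S t n) (val : {linear decay_chain S t n -> (n.+1.-tuple G -> R)}).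
move: A; apply: H; first exact: val_inj.
move=> A [r hr /decay_bounded_family[W [[q0 Wq0] Wpos WF Wb]]].
pose ok (z : n.+1.-tuple G) := nondegenerate z /\ diameter_le S r z.
pose D1 := [set d : seq (n.+1.-tuple G * R) | exists q, W q /\ exists s, uniq s /\
   d = [seq (z, q.1 (thead z) / q.2) | z <- s]].
(* The coefficient [N] is arbitrary, so a finite gauge forces [f z = 0] at every tuple that is
   degenerate or of diameter above [r]. *)
pose D2 := [set d : seq (n.+1.-tuple G * R) | exists z N, ~ ok z /\ d = [:: (z, N%:R)]].
have D0 : (D1 `|` D2) [::] by left; exists q0; split=> //; exists [::].
have Dc x : exists2 d, (D1 `|` D2) d & exists2 c : R, c != 0 & (x, c) \in d.
  exists [seq (z, q0.1 (thead z) / q0.2) | z <- [:: x]].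
    by left; exists q0; split=> //; exists [:: x].
  exists (q0.1 (thead x) / q0.2); last by rewrite inE.
  have [w0 c0] := Wpos _ Wq0.
  by rewrite mulf_neq0 ?invr_neq0 ?gt_eqF // (weight_gt0 _ w0).
pose D := DiskFamily D0 Dc.
have sumE q (s : seq (n.+1.-tuple G)) f : W q ->
    finite_weight [seq (z, q.1 (thead z) / q.2) | z <- s] f =
    (\sum_(z <- s) `|f z| * q.1 (thead z)) / q.2.
  move=> /Wpos[qw q2]; rewrite /finite_weight big_map mulr_suml.
  apply: eq_bigr => z _ /=; rewrite !normrM normfV (gtr0_norm q2).
  by rewrite ger0_norm ?(weight_ge0 _ qw) //; ring.
have w0 q z : W q -> 0 <= q.1 z by move=> /Wpos[/(weight_ge0 z)].
have normP q (f : n.+1.-tuple G -> R) (rho : R) : W q ->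
  (weighted_norm q.1 (marginal f) <= (rho * q.2)%:E)%E <->
  (forall s, uniq s ->
    finite_weight [seq (z, q.1 (thead z) / q.2) | z <- s] f <= rho).
  move=> Wq; have [qw q2] := Wpos _ Wq; rewrite (weighted_norm_marginal _ qw).
  have := @ge0_esum_leP R (n.+1.-tuple G) (fun z => `|f z| * q.1 (thead z)) (rho * q.2).
  move=> -> => [|x]; last by rewrite mulr_ge0 // w0.
  by split=> h s /h; rewrite sumE // ler_pdivrMr.
have diskP rho (f : n.+1.-tuple G -> R) : in_disk D rho f -> chain_supported S r f /\
    forall q, W q -> (weighted_norm q.1 (marginal f) <= (rho * q.2)%:E)%E.
  move=> h; split=> [z fz|q Wq]; last first.
    by apply/normP => // s us; apply: h; left; exists q; split=> //; exists s.
  apply: contrapT => nz; have := archi_boundP (_ : 0 <= `|rho| / `|f z|).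
  set N := Num.bound _ => /(_ (divr_ge0 (normr_ge0 _) (normr_ge0 _))).
  rewrite ltr_pdivrMr ?normr_gt0 // => hN.
  have : finite_weight [:: (z, N%:R)] f <= rho by apply: h; right; exists z, N.
  rewrite /finite_weight big_seq1 /= normrM normr_nat => /le_trans /(_ (ler_norm _)).
  by rewrite leNgt hN.
have diskb rho : chain_bounded S t [set f | in_disk D rho f].
  exists r => [f /diskP[]//|]; apply: sub_decay_bounded (Wb rho) => _ [f /diskP[_ h] <-].
  exact: h.
exists D; split.
- move=> v Av d [[q [Wq [s [us ->]]]]|[z [N [nz ->]]]].
    apply: (normP q (val v) 1 Wq).1 => //; rewrite mul1r; apply: WF => //.
    by exists (val v) => //; exists v.
  rewrite /finite_weight big_seq1 /=.
  have -> : decay_chain_val v z = 0.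
    by apply/eqP; apply: contra_notT nz; apply: hr; exists v.
  by rewrite mulr0 normr0 ler01.
- move=> rho; apply: chain_bounded_subset (diskb rho) => _ [v hv <-]; exact: hv.
- move=> rho f hf; have fP : f \in @in_decay_chain R G S t n.
    by apply/asboolP; apply: chain_bounded_subset (diskb rho) => _ ->.
  by exists (DecayChain fP).
Qed.

HB.instance Definition _ := isCompleteBornological.Build R (decay_chain S t n)
  decay_chain_complete.

End ChainsComplete.

(** * Fine spaces and finite bases *)

Section FineMaps.
Variable R : realType.

(** The vectors [g i] range over bounded sets instead of being fixed, because in [fine_bounded_map2]
    they depend on the other variable. *)
Lemma born_lincomb (W : bornType R) n (A : 'I_n -> set W) (C : R) :
  (forall i, born (A i)) ->
  born [set x | exists c g, (forall i, `|c i| <= C /\ A i (g i)) /\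
                            x = \sum_i c i *: g i].
Proof.
elim: n A => [|n IH] A hA.
  apply: born_subset (born_finite _ (finite_set1 0)).
  by move=> x [c [g [_ ->]]]; rewrite big_ord0.
have := born_add _ _ (born_scale C _ (hA ord0)) (IH _ (fun i => hA (lift ord0 i))).
apply: born_subset => _ [c [g [h ->]]]; rewrite big_ord_recl.
have [c0 g0] := h ord0; exists (c ord0 *: g ord0); first by exists (c ord0) => //; exists (g ord0).
by exists (\sum_i c (lift ord0 i) *: g (lift ord0 i)) => //;
  exists (c \o lift ord0), (g \o lift ord0); split=> // i; exact: h.
Qed.

(** The fine bornology is the smallest one on a vector space; hence linear maps out of a fine space
    are automatically bounded. *)
Lemma fine_born_born (W : bornType R) (A : set W) : fine_born A -> born A.
Proof.
move=> [n [b [C hA]]].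
have := @born_lincomb W n (fun i => [set b i]) C (fun i => born_finite _ (finite_set1 _)).
by apply: born_subset => x /hA[c cC ->]; exists c, b.
Qed.

Lemma fine_bounded_map (V W : bornType R) (f : {linear V -> W}) :
  (forall A : set V, born A -> fine_born A) -> bounded_map f.
Proof. by move=> fV A /fV /(fine_born_linear f) /fine_born_born. Qed.

(** A bounded set of the fine variable involves finitely many vectors [e i] with bounded
    coefficients, so separate boundedness at each [e i] suffices. *)
Lemma fine_bounded_map2 (U V W : bornType R) (b : U -> V -> W) :
  (forall A : set V, born A -> fine_born A) ->
  (forall u, linear (b u)) -> (forall v, bounded_map (b ^~ v)) -> bounded_map2 b.
Proof.
move=> fV lb bb A B hA /fV[n [e [C hB]]].
have := @born_lincomb W n _ C (fun i => bb (e i) _ hA).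
apply: born_subset => _ [u Au [v /hB[c cC ->] <-]].
exists c, (fun i => b u (e i)); split=> [i|]; first by split=> //; exists u.
pose bL := GRing.isLinear.Build R V W _ (b u) (lb u).
pose L : {linear V -> W} := HB.pack (b u) bL.
by rewrite -[LHS]/(L _) linear_sum; apply: eq_bigr => i _; rewrite linearZ.
Qed.

End FineMaps.

Section FiniteBasis.
Variables (R : realType) (V : lmodType R) (X : choiceType).

(* The vectors may vanish: [fb_vec] is 0 at the degenerate tuples below. *)
Record finite_basis := FiniteBasis {
  fb_coord : {linear V -> (X -> R)};
  fb_vec : X -> V;
  fb_finite : forall v, finite_set [set x | fb_coord v x != 0];
  fb_span : forall v (s : seq X), uniq s ->
    (forall x, fb_coord v x != 0 -> x \in s) ->
    v = \sum_(x <- s) fb_coord v x *: fb_vec x }.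

Variable B : finite_basis.
Local Notation coord := (fb_coord B).

Lemma fb_support v : exists2 s : seq X, uniq s & forall x, coord v x != 0 -> x \in s.
Proof.
have /finite_seqP[s hs] := fb_finite B v; exists (undup s); first exact: undup_uniq.
move=> x vx; rewrite mem_undup.
by have : [set x | coord v x != 0] x by []; rewrite hs.
Qed.

(** Linear for every [F], being defined through coordinates. It takes the value [F x] at [fb_vec x]
    only when the coordinates of that vector are those of a unit vector ([lin_ext_vec]), which fails
    at degenerate tuples. *)
Definition lin_ext (W : lmodType R) (F : X -> W) (v : V) : W :=
  \sum_(x \in [set: X]) coord v x *: F x.

Lemma lin_extE (W : lmodType R) (F : X -> W) v (s : seq X) :
  uniq s -> (forall x, coord v x != 0 -> x \in s) ->
  lin_ext F v = \sum_(x <- s) coord v x *: F x.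
Proof.
move=> us hs; rewrite /lin_ext -(@fsbig_widen _ _ _ _ [set` s]) //; first exact/esym/fsbig_seq.
move=> x [_ /= nx]; have [->|/hs//] := eqVneq (coord v x) 0; by rewrite scale0r.
Qed.

Lemma lin_ext_linear (W : lmodType R) (F : X -> W) : linear (lin_ext F).
Proof.
move=> a u v; have [s us hs] := fb_support u; have [r ur hr] := fb_support v.
have uq : uniq (undup (s ++ r)) by exact: undup_uniq.
have hsq x : coord u x != 0 -> x \in undup (s ++ r).
  by rewrite mem_undup mem_cat => /hs ->.
have hrq x : coord v x != 0 -> x \in undup (s ++ r).
  by rewrite mem_undup mem_cat => /hr ->; rewrite orbT.
rewrite (lin_extE F uq hsq) (lin_extE F uq hrq) (@lin_extE _ F _ _ uq); last first.
  move=> x; rewrite linearP -[(_ + _) x]/(a * coord u x + coord v x).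
  have [->|/hsq//] := eqVneq (coord u x) 0; rewrite mulr0 add0r; exact: hrq.
rewrite scaler_sumr -big_split; apply: eq_bigr => x _ /=.
by rewrite linearP -[(_ + _) x]/(a * coord u x + coord v x) scalerDl scalerA.
Qed.

HB.instance Definition _ (W : lmodType R) (F : X -> W) :=
  GRing.isLinear.Build R V W _ (lin_ext F) (@lin_ext_linear W F).

Lemma fb_linear (W : lmodType R) (L : {linear V -> W}) v :
  L v = lin_ext (L \o fb_vec B) v.
Proof.
have [s us hs] := fb_support v; rewrite (lin_extE _ us hs).
rewrite [in LHS](fb_span us hs) linear_sum; apply: eq_bigr => x _.
by rewrite linearZ.
Qed.

Lemma fb_linear_eq (W : lmodType R) (L L' : {linear V -> W}) :
  (forall x, L (fb_vec B x) = L' (fb_vec B x)) -> L =1 L'.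
Proof. by move=> h v; rewrite (fb_linear L) (fb_linear L'); congr lin_ext; apply/funext. Qed.

Lemma lin_ext_vec (W : lmodType R) (F : X -> W) x :
  (forall y, coord (fb_vec B x) y = (y == x)%:R) -> lin_ext F (fb_vec B x) = F x.
Proof.
move=> h; rewrite (@lin_extE _ _ _ [:: x]) //; last first.
  by move=> y; rewrite h inE; case: (y == x) => //; rewrite eqxx.
by rewrite big_seq1 h eqxx scale1r.
Qed.

End FiniteBasis.

Section GroupAlgebraBasis.
Variables (R : realType) (G : groupType).

Lemma galg_span (a : group_algebra R G) (s : seq G) : uniq s ->
  (forall x, a x != 0 -> x \in s) -> a = \sum_(x <- s) a x *: galg_delta R x.
Proof.
move=> us hs; apply: val_inj; rewrite linear_sum; apply/funext => y.
have E x : val (a x *: galg_delta R x) y = a x * (y == x)%:R by [].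
rewrite fct_sumE [LHS]/=; have [ys|ys] := boolP (y \in s); last first.
  rewrite big_seq big1; last first.
    by move=> x xs; rewrite [LHS]E; case: eqP xs ys => [->->//|]; rewrite mulr0.
  by apply/eqP; apply: contraNT ys; exact: hs.
rewrite (bigD1_seq y) //= [X in X + _]E eqxx mulr1.
by rewrite big1 ?addr0 // => x xy; rewrite [LHS]E eq_sym (negbTE xy) mulr0.
Qed.

Lemma galg_finite (a : group_algebra R G) : finite_set [set x | a x != 0].
Proof. exact/asboolP/(galg_valP a). Qed.

Definition galg_basis : finite_basis (group_algebra R G) G :=
  @FiniteBasis R (group_algebra R G) G
    (val : {linear group_algebra R G -> (G -> R)}) (@galg_delta R G) galg_finite galg_span.

Lemma lin_ext_galg (W : lmodType R) (F : G -> W) g :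
  lin_ext galg_basis F (galg_delta R g) = F g.
Proof. by rewrite (lin_ext_vec (B := galg_basis)). Qed.

Lemma galg_mul_delta (g h : G) :
  galg_mul (galg_delta R g) (galg_delta R h) = galg_delta R (g * h)%g.
Proof.
apply: val_inj; apply/funext => x /=; rewrite convolution_gdelta /gdelta.
by congr (nat_of_bool _)%:R; apply/eqP/eqP => [<-|->]; rewrite ?mulgK ?mulgVK.
Qed.

Lemma galg_aug_delta (g : G) : galg_aug (galg_delta R g) = 1.
Proof.
rewrite /galg_aug -(@fsbig_widen _ _ _ _ [set g]) //.
  by rewrite fsbig_set1 /= /gdelta eqxx.
by move=> x [_ /= xg]; rewrite /gdelta; case: eqP xg.
Qed.

End GroupAlgebraBasis.

Section ChainBasis.
Variables (R : realType) (G : groupType) (n : nat).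
Implicit Type z : n.+1.-tuple G.

Lemma chain_delta_in z :
  (fun w => (nondegenerate w && (w == z))%:R) \in @in_chain R G n.
Proof.
apply/asboolP; split; last by move=> w /negbTE ->.
apply: sub_finite_set (finite_set1 z) => w /=.
by case: (w =P z) => // _; rewrite andbF eqxx.
Qed.

(** Zero at degenerate tuples, so that formulas for boundaries and cones can be stated for all
    tuples. *)
Definition chain_delta z : chain R G n := Chain (chain_delta_in z).

Lemma chain_finite (c : chain R G n) : finite_set [set z | c z != 0].
Proof. by have /asboolP[] := chain_valP c. Qed.

Lemma chain_degenerate (c : chain R G n) z : ~~ nondegenerate z -> c z = 0.
Proof. by have /asboolP[_] := chain_valP c; apply. Qed.

Lemma chain_span (c : chain R G n) (s : seq (n.+1.-tuple G)) : uniq s ->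
  (forall z, c z != 0 -> z \in s) -> c = \sum_(z <- s) c z *: chain_delta z.
Proof.
move=> us hs; apply: val_inj; rewrite linear_sum; apply/funext => y.
have E z : val (c z *: chain_delta z) y = c z * (nondegenerate y && (y == z))%:R by [].
rewrite fct_sumE [LHS]/=; have [ys|ys] := boolP (y \in s); last first.
  rewrite big_seq big1; last first.
    by move=> z zs; rewrite [LHS]E; case: eqP zs ys => [->->//|]; rewrite andbF mulr0.
  by apply/eqP; apply: contraNT ys; exact: hs.
rewrite (bigD1_seq y) //= [X in X + _]E eqxx andbT.
rewrite big1 ?addr0 => [|z zy]; last first.
  by rewrite [LHS]E eq_sym (negbTE zy) andbF mulr0.
have [nd|/chain_degenerate ->] := boolP (nondegenerate y); by rewrite ?mulr1 ?mul0r.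
Qed.

Definition chain_basis : finite_basis (chain R G n) (n.+1.-tuple G) :=
  @FiniteBasis R (chain R G n) (n.+1.-tuple G)
    (val : {linear chain R G n -> (n.+1.-tuple G -> R)}) chain_delta chain_finite chain_span.

Lemma chain_delta0 z : ~~ nondegenerate z -> chain_delta z = 0.
Proof.
move=> nz; apply: val_inj; apply/funext => w /=.
by case: eqP => [->|]; rewrite ?(negbTE nz) ?andbF.
Qed.

Lemma lin_ext_chain (W : lmodType R) (F : n.+1.-tuple G -> W) z :
  nondegenerate z -> lin_ext chain_basis F (chain_delta z) = F z.
Proof.
move=> nz; rewrite (lin_ext_vec (B := chain_basis)) // => y /=.
by case: eqP => [->|]; rewrite ?nz ?andbF.
Qed.

(** A fine bounded set is supported on the finite union [supp] of the supports of the [b i].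
    One-point lists give a weighted sup norm there, and arbitrarily large coefficients force
    vanishing elsewhere, so the disk spans a finite-dimensional space. *)
Lemma chain_complete (A : set (chain R G n)) : born A ->
    exists (B : completeNormedModType R) (i : {linear B -> chain R G n}),
      [/\ injective i,
          forall r : R, born (i @` [set x : B | `|x| <= r]) &
          exists r : R, A `<=` i @` [set x : B | `|x| <= r]].
Proof.
have H := @born_complete_of_disks R _ (chain R G n)
  (val : {linear chain R G n -> (n.+1.-tuple G -> R)}).
move: A; apply: H; first exact: val_inj.
move=> A [m [b [C hA]]].
pose supp z := exists i, b i z != 0.
(* The 1 makes [M z] invertible, and [|C|] guards against a negative [C]. *)
pose M z := 1 + \sum_i `|C| * `|b i z|.
have M0 z : 0 < M z by rewrite ltr_wpDr // sumr_ge0.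
pose D0 := [set d : seq (n.+1.-tuple G * R) | [\/ d = [::],
   exists z, d = [:: (z, (M z)^-1)] | exists z N, ~ supp z /\ d = [:: (z, N%:R)]]].
have Dc x : exists2 d, D0 d & exists2 c : R, c != 0 & (x, c) \in d.
  exists [:: (x, (M x)^-1)]; first by constructor 2; exists x.
  by exists (M x)^-1; rewrite ?inE ?invr_neq0 ?gt_eqF.
have Dn : D0 [::] by constructor 1.
pose D := DiskFamily Dn Dc.
have diskP rho f : in_disk D rho f ->
    (forall z, f z != 0 -> supp z) /\ forall z, `|f z| <= rho * M z.
  move=> h; split=> z.
    move=> fz; apply: contrapT => nz.
    have := archi_boundP (_ : 0 <= `|rho| / `|f z|).
    set N := Num.bound _ => /(_ (divr_ge0 (normr_ge0 _) (normr_ge0 _))).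
    rewrite ltr_pdivrMr ?normr_gt0 // => hN.
    have : finite_weight [:: (z, N%:R)] f <= rho by apply: h; constructor 3; exists z, N.
    rewrite /finite_weight big_seq1 /= normrM normr_nat => /le_trans /(_ (ler_norm _)).
    by rewrite leNgt hN.
  have : finite_weight [:: (z, (M z)^-1)] f <= rho by apply: h; constructor 2; exists z.
  by rewrite /finite_weight big_seq1 /= normrM gtr0_norm ?invr_gt0 // ler_pdivrMl // mulrC.
have fsupp : finite_set supp.
  have : finite_set (\bigcup_(i in [set: 'I_m]) [set z | b i z != 0]).
    by apply: bigcup_finite => // i _; exact: chain_finite.
  by apply: sub_finite_set => z [i iz]; exists i.
have [s us suppE] : exists2 s : seq (n.+1.-tuple G), uniq s & supp = [set` s].
  have /finite_seqP[s0 e0] := fsupp; exists (undup s0); first exact: undup_uniq.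
  by rewrite e0; apply/seteqP; split=> x /=; rewrite mem_undup.
exists D; split.
- move=> v /hA[c cC ->] d.
  have vE z : chain_val (\sum_i c i *: b i) z = \sum_i c i * b i z.
    by rewrite -[chain_val _]/(val _) linear_sum fct_sumE.
  move=> [->|[z ->]|[z [N [nz ->]]]].
  + by rewrite /finite_weight big_nil.
  + rewrite /finite_weight big_seq1 /= normrM gtr0_norm ?invr_gt0 // ler_pdivrMl // mulr1.
    rewrite vE ler_wpDl //; apply: le_trans (ler_norm_sum _ _ _) _.
    apply: ler_sum => i _; rewrite normrM.
    by rewrite ler_wpM2r // (le_trans (cC i)) // ler_norm.
  + rewrite /finite_weight big_seq1 /= vE big1 ?mulr0 ?normr0 //.
    move=> i _; have -> : b i z = 0 by apply/eqP; apply: contra_notT nz; exists i.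
    by rewrite mulr0.
- move=> rho; exists (size s), (fun i => chain_delta (tnth (in_tuple s) i)).
  exists (`|rho| * \sum_(z <- s) M z) => v /diskP[vs vM].
  exists (fun i => v (tnth (in_tuple s) i)).
    move=> i; apply: le_trans (vM _) _; set z := tnth _ i.
    have zs : z \in s by rewrite /z mem_tnth.
    apply: (@le_trans _ _ (`|rho| * M z)); first by rewrite ler_wpM2r ?ler_norm // ltW.
    rewrite ler_wpM2l //.
    by rewrite (big_rem z) //= lerDl sumr_ge0 // => w _; exact: ltW.
  rewrite [LHS](chain_span us); first by rewrite [LHS]big_tnth.
  by move=> z /vs; rewrite suppE.
- move=> rho f /diskP[fs _].
  have fP : f \in @in_chain R G n.
    apply/asboolP; split; first by apply: sub_finite_set fsupp => z /=; exact: fs.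
    move=> z nz; apply/eqP; apply: contraNT nz => /fs[i biz].
    by apply: contraNT biz => /chain_degenerate ->.
  by exists (Chain fP).
Qed.

HB.instance Definition _ := isCompleteBornological.Build R (chain R G n)
  chain_complete.

End ChainBasis.

(** * Relatively projective modules and their resolutions *)

Section Packing.
Variable R : realType.

Definition mk_linear (U V : lmodType R) (f : U -> V) (lf : linear f) :
    {linear U -> V} :=
  let fL := GRing.isLinear.Build R U V _ f lf in HB.pack f fL.

Definition mk_bilinear (U V W : lmodType R) (b : U -> V -> W)
    (lb : bilinear_for *:%R *:%R b) : {bilinear U -> V -> W} :=
  let bL := bilinear_isBilinear.Build R U V W *:%R *:%R b lb in HB.pack b bL.

Lemma bounded_comp (U V W : bornType R) (f : V -> W) (g : U -> V) :
  bounded_map f -> bounded_map g -> bounded_map (f \o g).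
Proof. by move=> bf bg A /bg /bf; rewrite image_comp. Qed.

Lemma bounded_lin (U V : bornType R) a (f g : U -> V) :
  bounded_map f -> bounded_map g -> bounded_map (fun x => a *: f x + g x).
Proof.
move=> bf bg A hA; have := born_add _ _ (born_scale `|a| _ (bf _ hA)) (bg _ hA).
apply: born_subset => _ [x Ax <-]; exists (a *: f x); last by exists (g x) => //; exists x.
by exists a => //=; exists (f x) => //; exists x.
Qed.

Lemma bounded_id (U : bornType R) : bounded_map (@id U).
Proof. by move=> A; rewrite image_id. Qed.

End Packing.

Section LinExtParam.
Variables (R : realType) (V : lmodType R) (X : choiceType) (B : finite_basis V X).

Lemma lin_ext_linear_param (U W : lmodType R) (F : X -> U -> W) v :
  (forall x, linear (F x)) -> linear (fun u => lin_ext B (F ^~ u) v).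
Proof.
move=> lF a u u'; have [s us hs] := fb_support B v.
rewrite !(lin_extE _ us hs) scaler_sumr -big_split /=; apply: eq_bigr => x _.
by rewrite lF scalerDr !scalerA mulrC.
Qed.

Lemma lin_ext_bounded_param (U W : bornType R) (F : X -> U -> W) v :
  (forall x, bounded_map (F x)) -> bounded_map (fun u => lin_ext B (F ^~ u) v).
Proof.
move=> bF A hA; have [s us hs] := fb_support B v.
pose x_ (i : 'I_(size s)) := tnth (in_tuple s) i.
have := @born_lincomb R W (size s) _ (\sum_(x <- s) `|fb_coord B v x|)
  (fun i => bF (x_ i) _ hA).
apply: born_subset => _ [u Au <-]; rewrite (lin_extE _ us hs).
exists (fun i => fb_coord B v (x_ i)), (fun i => F (x_ i) u).
split=> [i|]; last by rewrite [LHS]big_tnth.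
split; last by exists u.
rewrite (big_rem (x_ i)) ?mem_tnth //= lerDl; exact: sumr_ge0.
Qed.

End LinExtParam.

(** Dependent choice for objects whose type varies with the degree: [P] is the invariant that
    permits the next choice, [Q] links consecutive degrees. *)
Lemma dependent_sequence (T : nat -> Type) (P : forall n, T n -> Prop)
    (Q : forall n, T n -> T n.+1 -> Prop) :
  (exists x, P 0 x) -> (forall n x, P n x -> exists y, P n.+1 y /\ Q n x y) ->
  exists s : forall n, T n, forall n, P n (s n) /\ Q n (s n) (s n.+1).
Proof.
move=> /cid[x0 Px0] H.
pose step n (x : {x : T n | P n x}) : {y | P n.+1 y /\ Q n (sval x) y} :=
  cid (H n (sval x) (svalP x)).
pose s := fix s n : {x : T n | P n x} :=
  if n is m.+1 then exist _ (sval (step m (s m))) (svalP (step m (s m))).1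
  else exist _ x0 Px0.
exists (fun n => sval (s n)) => n; split; first exact: svalP.
exact: (svalP (step n (s n))).2.
Qed.

Section GModules.
Variables (R : realType) (G : groupType).

(** Only group elements act, since the balancing relations see nothing else; this treats C_n(G) and
    R[G]-modules alike. *)
Record is_gmodule (M : bornType R) (act : G -> M -> M) : Prop := IsGModule {
  gmod_linear : forall g, linear (act g);
  gmod_bounded : forall g, bounded_map (act g);
  gmod_act1 : forall m, act 1%g m = m;
  gmod_actM : forall g h m, act (g * h)%g m = act g (act h m) }.

Definition equivariant (M N : Type) (actM : G -> M -> M) (actN : G -> N -> N)
    (f : M -> N) : Prop := forall g m, f (actM g m) = actN g (f m).

(* Every bounded linear map s can be replaced by an equivariant one without
   changing the composites p \o s that are already equivariant. *)
Definition relatively_projective (M : bornType R) (actM : G -> M -> M) : Prop :=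
  forall (N : cbornType R) (actN : G -> N -> N), is_gmodule actN ->
  forall s : {linear M -> N}, bounded_map s ->
  exists f : {linear M -> N}, [/\ bounded_map f, equivariant actM actN f &
    forall (N' : cbornType R) (actN' : G -> N' -> N') (p : {linear N -> N'}),
      bounded_map p -> equivariant actN actN' p ->
      equivariant actM actN' (p \o s) -> forall m, p (f m) = p (s m)].

(** The map is f(a (x) v) = a s(1 (x) v). If p s is equivariant, then p f and p s are equivariant
    and agree on 1 (x) v, hence on all delta_g (x) v, which determine bounded linear maps. *)
Lemma free_relatively_projective (M : cbornType R)
    (act : {bilinear group_algebra R G -> M -> M}) :
  bounded_map2 act -> is_free_module act ->
  relatively_projective (fun g => act (galg_delta R g)).
Proof.
move=> bact [V [tens [tensP tensM]]] N actN hN s bs.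
have dens (E : cbornType R) (f f' : {linear M -> E}) : bounded_map f -> bounded_map f' ->
    (forall g v, f (tens (galg_delta R g) v) = f' (tens (galg_delta R g) v)) -> f =1 f'.
  move=> bf bf' ff'; apply: (ctensor_eq tensP) => // a v.
  have lt (F : {linear M -> E}) : linear (fun a => F (tens a v)).
    by move=> c u u'; rewrite linearPl linearP.
  exact: (fb_linear_eq (B := galg_basis R G) (L := mk_linear (lt f))
    (L' := mk_linear (lt f')) (fun g => ff' g v) a).
pose F g v := actN g (s (tens (galg_delta R 1%g) v)).
have lF g : linear (F g).
  by move=> a v w; rewrite /F linearPr linearP (gmod_linear hN).
have btens : bounded_map (tens (galg_delta R 1%g)).
  move=> A hA; have := tensP.1 _ _ (born_finite _ (finite_set1 (galg_delta R 1%g))) hA.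
  by apply: born_subset => _ [v Av <-]; exists (galg_delta R 1%g) => //; exists v.
have bF g : bounded_map (F g).
  exact: (bounded_comp (gmod_bounded hN g) (bounded_comp bs btens)).
pose b a v := lin_ext (galg_basis R G) (F ^~ v) a.
have lb : bilinear_for *:%R *:%R b.
  split=> [v|a]; first exact: lin_ext_linear.
  exact: lin_ext_linear_param.
have bb : bounded_map2 b.
  (* The arguments are exchanged because the fine space R[G] must be the second variable in
     [fine_bounded_map2]. *)
  have H : bounded_map2 (fun v a => b a v).
    apply: fine_bounded_map2 => [A //|v|a]; first exact: lin_ext_linear.
    exact: lin_ext_bounded_param.
  move=> A A' hA hA'; have := H _ _ hA' hA; apply: born_subset.
  by move=> _ [a Aa [v Av <-]]; exists v => //; exists a.
have [f [bf fE _]] := tensP.2 N (mk_bilinear lb) bb.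
have fD g v : f (tens (galg_delta R g) v) = actN g (s (tens (galg_delta R 1%g) v)).
  by rewrite fE /= /b lin_ext_galg.
have lact g : linear (act (galg_delta R g)) by move=> a x y; rewrite linearPr.
have bactg g : bounded_map (act (galg_delta R g)).
  move=> A hA; have := bact _ _ (born_finite _ (finite_set1 (galg_delta R g))) hA.
  by apply: born_subset => _ [x Ax <-]; exists (galg_delta R g) => //; exists x.
exists f; split=> // [g|N' actN' p bp ep eps].
  have lfa : linear (f \o act (galg_delta R g)) by move=> a x y /=; rewrite linearPr linearP.
  have laf : linear (actN g \o f) by move=> a x y /=; rewrite linearP (gmod_linear hN).
  have := dens N (mk_linear lfa) (mk_linear laf); apply.
  - exact: bounded_comp.
  - exact: (bounded_comp (gmod_bounded hN g)).
  move=> h v /=; rewrite tensM galg_mul_delta !fD.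
  by rewrite (gmod_actM hN).
have := dens N' (p \o f) (p \o s); apply; [exact: bounded_comp|exact: bounded_comp|].
move=> g v /=; rewrite fD ep.
have /= <- := eps g (tens (galg_delta R 1%g) v).
by rewrite tensM galg_mul_delta mulg1.
Qed.

Lemma action_is_gmodule (M : bornType R) (act : {bilinear group_algebra R G -> M -> M}) :
  is_module_action act -> is_gmodule (fun g => act (galg_delta R g)).
Proof.
move=> [bact act1 actM]; split=> // [g a x y|g A hA|g h m].
- by rewrite linearPr.
- have := bact _ _ (born_finite _ (finite_set1 (galg_delta R g))) hA.
  by apply: born_subset => _ [x Ax <-]; exists (galg_delta R g) => //; exists x.
- by rewrite -galg_mul_delta actM.
Qed.

Lemma chain_act_delta n (g : G) (z : n.+1.-tuple G) :
  chain_gact g (chain_delta R z) = chain_delta R (gact g z).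
Proof.
apply: val_inj; apply/funext => w /=; rewrite nondegenerate_gact.
congr ((_ && _)%:R); apply/eqP/eqP => [<-|->]; by rewrite ?gactVK ?gactK.
Qed.

Lemma chain_gact_linear n (g : G) : linear (@chain_gact R G n g).
Proof. by move=> a c d; apply: val_inj; apply/funext. Qed.

Lemma chain_is_gmodule n : is_gmodule (@chain_gact R G n).
Proof.
split=> [||c|g h c].
- exact: chain_gact_linear.
- by move=> g; apply: (fine_bounded_map (mk_linear (@chain_gact_linear n g))).
- apply: val_inj; apply/funext => z /=; congr (chain_val c).
  by apply: eq_from_tnth => i; rewrite tnth_map invg1 mul1g.
- apply: val_inj; apply/funext => z /=; congr (chain_val c).
  by apply: eq_from_tnth => i; rewrite !tnth_map invgM mulgA.
Qed.

Lemma chain_linear_eq n (W : lmodType R) (L L' : {linear chain R G n -> W}) :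
  (forall z, nondegenerate z -> L (chain_delta R z) = L' (chain_delta R z)) -> L =1 L'.
Proof.
move=> h; apply: (fb_linear_eq (B := chain_basis R G n)) => z /=.
have [/h//|/chain_delta0] := boolP (nondegenerate z).
by move=> /(_ R) ->; rewrite !linear0.
Qed.

(** G acts freely on tuples, and g^-1 z with g = [thead z] represents the orbit of z by a tuple
    starting with 1. Correcting [s] on representatives gives z |-> g s(g^-1 z), which is
    equivariant; boundedness is automatic on a fine space. *)
Lemma chain_relatively_projective n : relatively_projective (@chain_gact R G n).
Proof.
move=> N actN hN s bs.
pose F z := actN (thead z) (s (chain_gact (thead z)^-1%g (chain_delta R z))).
exists (lin_ext (chain_basis R G n) F); split.
- exact: fine_bounded_map.
- move=> g m.
  have l1 : linear (lin_ext (chain_basis R G n) F \o chain_gact g).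
    by move=> a x y /=; rewrite chain_gact_linear linearP.
  have l2 : linear (actN g \o lin_ext (chain_basis R G n) F).
    by move=> a x y /=; rewrite linearP (gmod_linear hN).
  apply: (chain_linear_eq (L := mk_linear l1) (L' := mk_linear l2)) => z nz /=.
  rewrite chain_act_delta !lin_ext_chain ?nondegenerate_gact //.
  rewrite -(gmod_actM hN) /F -chain_act_delta.
  rewrite -(gmod_actM (chain_is_gmodule n)).
  have -> : thead (gact g z) = (g * thead z)%g by rewrite /thead tnth_map.
  by rewrite invgM mulgVK.
move=> N' actN' p bp ep eps m.
apply: (chain_linear_eq (L := p \o lin_ext (chain_basis R G n) F) (L' := p \o s)).
move=> z nz /=; rewrite lin_ext_chain // /F ep -[p (s _)]/((p \o s) _) -eps.
by rewrite -(gmod_actM (chain_is_gmodule n)) mulgV (gmod_act1 (chain_is_gmodule n)).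
Qed.

End GModules.

(** * Comparison of relatively projective resolutions *)

Section Resolutions.
Variables (R : realType) (G : groupType).

(** Common ground for C_n(G) and free resolutions. The contraction is only linear and bounded, not
    equivariant. *)
Record projective_resolution := ProjectiveResolution {
  pr_obj :> nat -> cbornType R;
  pr_act : forall n, G -> pr_obj n -> pr_obj n;
  pr_gmod : forall n, is_gmodule (@pr_act n);
  pr_proj : forall n, relatively_projective (@pr_act n);
  pr_d : forall n, {linear pr_obj n.+1 -> pr_obj n};
  pr_d_bounded : forall n, bounded_map (pr_d n);
  pr_d_act : forall n, equivariant (@pr_act n.+1) (@pr_act n) (pr_d n);
  pr_dd : forall n x, pr_d n (pr_d n.+1 x) = 0;
  pr_aug : {linear pr_obj 0 -> R^o};
  pr_aug_bounded : bounded_map pr_aug;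
  pr_aug_act : equivariant (@pr_act 0) (fun _ => id) pr_aug;
  pr_aug_d : forall x, pr_aug (pr_d 0 x) = 0;
  pr_contractible :
    exists (s : {linear R^o -> pr_obj 0})
           (h : forall n, {linear pr_obj n -> pr_obj n.+1}),
      [/\ bounded_map s /\ forall n, bounded_map (h n),
          forall c, pr_aug (s c) = c,
          forall x, s (pr_aug x) + pr_d 0 (h 0 x) = x &
          forall n x, h n (pr_d n x) + pr_d n.+1 (h n.+1 x) = x] }.

Section Comparison.
Variables X Y : projective_resolution.

(** The bounded map h f d lifts f d through the boundary of Y but need not be equivariant. Relative
    projectivity replaces it by an equivariant f' with the same boundary. *)
Lemma exists_chain_map : exists f : forall n, {linear X n -> Y n},
  [/\ forall n, bounded_map (f n),
      forall n, equivariant (@pr_act X n) (@pr_act Y n) (f n),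
      forall x, pr_aug Y (f 0 x) = pr_aug X x &
      forall n x, f n (pr_d X n x) = pr_d Y n (f n.+1 x)].
Proof.
have [s [h [[bs bh] augs h0 hn]]] := pr_contractible Y.
(* The third clause says that [h] lifts f d. It is part of the invariant because its proof uses the
   augmentation in degree 0 and the previous square above it. The last clause exists only in degree
   0. *)
pose P n (f : {linear X n -> Y n}) :=
  [/\ bounded_map f, equivariant (@pr_act X n) (@pr_act Y n) f,
      forall x, pr_d Y n (h n (f (pr_d X n x))) = f (pr_d X n x) &
      (if n is 0 return ({linear X n -> Y n} -> Prop)
       then fun f => forall x, pr_aug Y (f x) = pr_aug X x else fun=> True) f].
pose Q n (f : {linear X n -> Y n}) (f' : {linear X n.+1 -> Y n.+1}) :=
  forall x, f (pr_d X n x) = pr_d Y n (f' x).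
have [||f Hf] := @dependent_sequence (fun n => {linear X n -> Y n}) P Q.
- have [f [bf ef pf]] := pr_proj (pr_gmod Y 0) (s := s \o pr_aug X)
    (bounded_comp bs (pr_aug_bounded (p := X))).
  have augf x : pr_aug Y (f x) = pr_aug X x.
    rewrite (pf R^o (fun _ => id)) /= ?augs //; first exact: pr_aug_bounded.
      exact: pr_aug_act.
    by move=> g m /=; rewrite !augs pr_aug_act.
  exists f; split=> // x.
  by have := h0 (f (pr_d X 0 x)); rewrite augf pr_aug_d linear0 add0r.
- move=> n f [bf ef df _].
  have [|f' [bf' ef' pf']] := @pr_proj X n.+1 _ _ (pr_gmod Y n.+1) (h n \o (f \o pr_d X n)).
    exact: (bounded_comp (bh n) (bounded_comp bf (@pr_d_bounded X n))).
  have d' x : f (pr_d X n x) = pr_d Y n (f' x).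
    rewrite (pf' _ _ (pr_d Y n) (@pr_d_bounded Y n) (@pr_d_act Y n)) /= ?df //.
    by move=> g m /=; rewrite !df pr_d_act ef.
  exists f'; split=> //; split=> // x.
  have := hn n (f' (pr_d X n.+1 x)); rewrite -d' pr_dd !linear0 add0r //.
exists f; split.
- by move=> n; have [[]] := Hf n.
- by move=> n; have [[]] := Hf n.
- by move=> x; have [[_ _ _ /(_ x)]] := Hf 0.
- by move=> n x; have [_] := Hf n; apply.
Qed.

Lemma exists_homotopy (u : forall n, {linear X n -> Y n}) :
  (forall n, bounded_map (u n)) ->
  (forall n, equivariant (@pr_act X n) (@pr_act Y n) (u n)) ->
  (forall x, pr_aug Y (u 0 x) = 0) ->
  (forall n x, u n (pr_d X n x) = pr_d Y n (u n.+1 x)) ->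
  exists H : forall n, {linear X n -> Y n.+1},
  [/\ forall n, bounded_map (H n),
      forall n, equivariant (@pr_act X n) (@pr_act Y n.+1) (H n),
      forall x, u 0 x = pr_d Y 0 (H 0 x) &
      forall n x, u n.+1 x = pr_d Y n.+1 (H n.+1 x) + H n (pr_d X n x)].
Proof.
move=> bu eu augu ud.
have [s [h [[bs bh] augs h0 hn]]] := pr_contractible Y.
(* The third clause is the homotopy identity on boundaries, where the lower term vanishes; it makes
   the next error u - H d a cycle. The clause [n = 0] keeps the initial identity, which [Q] does not
   express. *)
pose P n (H : {linear X n -> Y n.+1}) :=
  [/\ bounded_map H, equivariant (@pr_act X n) (@pr_act Y n.+1) H,
      forall x, pr_d Y n (H (pr_d X n x)) = u n (pr_d X n x) &
      n = 0 -> forall x, u n x = pr_d Y n (H x)].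
pose Q n (H : {linear X n -> Y n.+1}) (H' : {linear X n.+1 -> Y n.+2}) :=
  forall x, u n.+1 x = pr_d Y n.+1 (H' x) + H (pr_d X n x).
have [||H HH] := @dependent_sequence (fun n => {linear X n -> Y n.+1}) P Q.
- have [|H [bH eH pH]] := @pr_proj X 0 _ _ (pr_gmod Y 1) (h 0 \o u 0).
    exact: bounded_comp.
  have E x : pr_d Y 0 (h 0 (u 0 x)) = u 0 x.
    by have := h0 (u 0 x); rewrite augu linear0 add0r.
  have dH x : u 0 x = pr_d Y 0 (H x).
    rewrite (pH _ _ (pr_d Y 0) (@pr_d_bounded Y 0) (@pr_d_act Y 0)) /= ?E //.
    by move=> g m /=; rewrite !E eu.
  by exists H; split.
- move=> n H [bH eH dH _].
  pose v := u n.+1 \- (H \o pr_d X n).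
  have bv : bounded_map v.
    have := bounded_lin (- 1) (bounded_comp bH (@pr_d_bounded X n)) (bu n.+1).
    congr bounded_map; apply/funext => x /=.
    by rewrite scaleN1r addrC.
  have ev : equivariant (@pr_act X n.+1) (@pr_act Y n.+1) v.
    move=> g m; rewrite /v /= eu pr_d_act eH.
    have l := gmod_linear (pr_gmod Y n.+1) g.
    by have /= := linearB (mk_linear l).
  have dv x : pr_d Y n (v x) = 0 by rewrite /v /= linearB dH -ud subrr.
  have E x : pr_d Y n.+1 (h n.+1 (v x)) = v x.
    by have := hn n (v x); rewrite dv linear0 add0r.
  have [|H' [bH' eH' pH']] := @pr_proj X n.+1 _ _ (pr_gmod Y n.+2) (h n.+1 \o v).
    exact: bounded_comp.
  have dH' x : pr_d Y n.+1 (H' x) = v x.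
    rewrite (pH' _ _ (pr_d Y n.+1) (@pr_d_bounded Y n.+1) (@pr_d_act Y n.+1)) /= ?E //.
    by move=> g m /=; rewrite !E ev.
  exists H'; split=> [|x]; last by rewrite dH' /v /= subrK.
  by split=> // x; rewrite dH' -[v _]/(u n.+1 _ - H (pr_d X n _)) pr_dd linear0 subr0.
exists H; split.
- by move=> n; have [[]] := HH n.
- by move=> n; have [[]] := HH n.
- by have [[_ _ _ /(_ erefl)]] := HH 0.
- by move=> n; have [_] := HH n.
Qed.

End Comparison.

Lemma resolutions_homotopic (X Y : projective_resolution)
    (f : forall n, {linear X n -> Y n}) (g : forall n, {linear Y n -> X n}) :
  (forall n, bounded_map (f n)) -> (forall n, bounded_map (g n)) ->
  (forall n, equivariant (@pr_act X n) (@pr_act Y n) (f n)) ->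
  (forall n, equivariant (@pr_act Y n) (@pr_act X n) (g n)) ->
  (forall x, pr_aug Y (f 0 x) = pr_aug X x) ->
  (forall x, pr_aug X (g 0 x) = pr_aug Y x) ->
  (forall n x, f n (pr_d X n x) = pr_d Y n (f n.+1 x)) ->
  (forall n x, g n (pr_d Y n x) = pr_d X n (g n.+1 x)) ->
  exists H : forall n, {linear X n -> X n.+1},
  [/\ forall n, bounded_map (H n),
      forall n, equivariant (@pr_act X n) (@pr_act X n.+1) (H n),
      forall x, g 0 (f 0 x) - x = pr_d X 0 (H 0 x) &
      forall n x, g n.+1 (f n.+1 x) - x = pr_d X n.+1 (H n.+1 x) + H n (pr_d X n x)].
Proof.
move=> bf bg ef eg af ag fd gd.
pose u n : {linear X n -> X n} := (g n \o f n) \- idfun.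
apply: (@exists_homotopy X X u).
- move=> n; have := bounded_lin (- 1) (@bounded_id R (X n)) (bounded_comp (bg n) (bf n)).
  congr bounded_map; apply/funext => x /=.
  by rewrite scaleN1r addrC.
- move=> n x m /=; rewrite ef eg.
  have l := gmod_linear (pr_gmod X n) x.
  by have /= := linearB (mk_linear l).
- by move=> x /=; rewrite linearB ag af subrr.
- by move=> n x /=; rewrite fd gd linearB.
Qed.

End Resolutions.

(** * Finite chains as a resolution *)

Section TupleFaces.
Variable G : groupType.

Lemma face_gact n (j : 'I_n.+1) (g : G) (z : n.+1.-tuple G) :
  face j (gact g z) = gact g (face j z).
Proof. by apply: eq_from_tnth => i; rewrite tnth_mktuple !tnth_map tnth_ord_tuple. Qed.

Lemma thead_gact n (g : G) (z : n.+1.-tuple G) : thead (gact g z) = (g * thead z)%g.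
Proof. by rewrite /thead tnth_map. Qed.

Lemma face_cons0 n (x : G) (z : n.+1.-tuple G) : face ord0 [tuple of x :: z] = z.
Proof.
apply: eq_from_tnth => i; by rewrite tnth_mktuple !(tnth_nth x).
Qed.

Lemma face_consS n (j : 'I_n.+1) (x : G) (z : n.+1.-tuple G) :
  face (lift ord0 j) [tuple of x :: z] = [tuple of x :: face j z].
Proof.
apply: eq_from_tnth => i; rewrite tnth_mktuple !(tnth_nth x) /=.
case: i => -[|i] hi /=; first by rewrite /bump.
have hi' : (i < n)%N by [].
transitivity (tnth (face j z) (Ordinal hi')); last by rewrite (tnth_nth x).
rewrite tnth_mktuple (tnth_nth x) /=.
have -> : bump (bump 0 j) i.+1 = (bump j i).+1 by rewrite /bump; lia.
by [].
Qed.

Lemma nondegenerate_singleton (z : 1.-tuple G) : nondegenerate z.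
Proof. by case: z => -[|x [|y s]]. Qed.

Lemma nondegenerate_consW n (x : G) (z : n.+1.-tuple G) :
  nondegenerate [tuple of x :: z] -> nondegenerate z.
Proof. exact: path_sorted. Qed.

End TupleFaces.

(** * Chains along a single orbit and their boundary *)

Section Push.
Variables (R : realType) (G : groupType).

(* The function phi transported along the orbit map g |-> g z, that is, the
   convolution of phi with the characteristic function of z; the quotient
   (thead w)(thead z)^-1 recovers g from w = g z. *)
Definition push n (phi : G -> R) (z : n.+1.-tuple G) : n.+1.-tuple G -> R :=
  fun w => let g := (thead w * (thead z)^-1)%g in
    if nondegenerate w && (w == gact g z) then phi g else 0.

Lemma push_gact n phi (z : n.+1.-tuple G) g : nondegenerate z ->
  push phi z (gact g z) = phi g.
Proof. by move=> nz; rewrite /push nondegenerate_gact nz thead_gact mulgK eqxx. Qed.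

Lemma push_eq0 n phi (z w : n.+1.-tuple G) : (forall g, w <> gact g z) -> push phi z w = 0.
Proof. by rewrite /push => h; case: eqP => [/h//|]; rewrite andbF. Qed.

Lemma push_degenerate n phi (z : n.+1.-tuple G) : ~~ nondegenerate z -> push phi z = 0.
Proof.
move=> nz; apply/funext => w; rewrite /push; case: eqP => [->|]; last by rewrite andbF.
by rewrite nondegenerate_gact (negbTE nz).
Qed.

Lemma push_linear n (z : n.+1.-tuple G) : linear (fun phi => push phi z).
Proof.
move=> a phi psi; apply/funext => w; rewrite -[RHS]/(a * push phi z w + push psi z w) /push.
by case: ifP => // _; rewrite mulr0 addr0.
Qed.

Lemma push_gdelta n (z : n.+1.-tuple G) :
  push (gdelta R 1%g) z = (fun w => (nondegenerate w && (w == z))%:R).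
Proof.
apply/funext => w; rewrite /push; case: nondegenerate => //=.
case: eqP => [wz|nwz]; last first.
  case: eqP => // wz; case: nwz; rewrite wz mulgV.
  by apply: eq_from_tnth => i; rewrite tnth_map mul1g.
rewrite /gdelta; congr (nat_of_bool _)%:R; apply/eqP/eqP => [g1|->]; last exact: mulgV.
by rewrite wz g1; apply: eq_from_tnth => i; rewrite tnth_map mul1g.
Qed.

(** For given [j] and [y], at most one point h z of the orbit has j-th face [y], since first entries
    determine h. Each fibre sum therefore has at most one nonzero term. *)
Lemma boundary_push n phi (z : n.+2.-tuple G) : nondegenerate z ->
  boundary (push phi z) = \sum_(j < n.+2) (-1) ^+ j *: push phi (face j z).
Proof.
move=> nz; apply/funext => y; rewrite fct_sumE /boundary.
case: ifP => ny; last first.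
  rewrite big1 // => j _; rewrite -[LHS]/((-1) ^+ j * push phi (face j z) y).
  by rewrite /push ny /= mulr0.
apply: eq_bigr => j _; rewrite -[RHS]/((-1) ^+ j * push phi (face j z) y).
congr (_ * _); set g := (thead y * (thead (face j z))^-1)%g.
have uniq_g w h : face j w = y -> w = gact h z -> h = g.
  by move=> wy wh; rewrite /g -wy wh !face_gact !thead_gact mulgK.
have -> : push phi (face j z) y = if y == gact g (face j z) then phi g else 0.
  by rewrite /push ny.
case: eqP => [yz|nyz].
  rewrite -(@fsbig_widen _ _ _ _ [set gact g z]) //.
  - by rewrite fsbig_set1 push_gact.
  - by move=> w ->; rewrite /= face_gact.
  move=> w [/= wy nwz]; apply: push_eq0 => h wh; apply: nwz.
  by rewrite /= wh (uniq_g _ _ wy wh).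
apply: fsbig1 => w wy; apply: push_eq0 => h wh; apply: nyz.
by rewrite -(uniq_g _ _ wy wh) -face_gact -wh wy.
Qed.

End Push.

Section ChainResolution.
Variables (R : realType) (G : groupType).

(** For nondegenerate [z] this is [boundary_push] at the unit of the group algebra; for degenerate
    [z] the two faces at a repeated entry cancel and the remaining ones are degenerate. *)
Lemma chain_boundary_delta n (z : n.+2.-tuple G) :
  chain_boundary (chain_delta R z) = \sum_(j < n.+2) (-1) ^+ j *: chain_delta R (face j z).
Proof.
have E (y : n.+1.-tuple G) : chain_val (\sum_(j < n.+2) (-1) ^+ j *: chain_delta R (face j z)) y =
    \sum_(j < n.+2) (-1) ^+ j * (nondegenerate y && (y == face j z))%:R.
  by rewrite -[chain_val _]/(val _) linear_sum fct_sumE.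
apply: val_inj; apply/funext => y; rewrite [RHS]E.
have [nz|nz] := boolP (nondegenerate z).
  rewrite /= -push_gdelta boundary_push // fct_sumE; apply: eq_bigr => j _.
  by rewrite push_gdelta.
rewrite chain_delta0 // -[chain_boundary 0]/(@chain_boundary R G n 0) linear0.
have [ny|ny] := boolP (nondegenerate y); last by rewrite /= big1 // => j _; rewrite mulr0.
rewrite /= -[LHS](alternating_degenerate R ny nz).
by apply: eq_bigr => j _; rewrite eq_sym.
Qed.

Definition chain_cone n : {linear chain R G n -> chain R G n.+1} :=
  lin_ext (chain_basis R G n) (fun z => chain_delta R [tuple of 1%g :: z]).

Lemma chain_cone_delta n (z : n.+1.-tuple G) :
  chain_cone n (chain_delta R z) = chain_delta R [tuple of 1%g :: z].
Proof.
have [nz|nz] := boolP (nondegenerate z); first exact: lin_ext_chain.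
rewrite [in LHS]chain_delta0 // linear0 chain_delta0 //.
by apply: contra nz; exact: nondegenerate_consW.
Qed.

Definition chain_aug : {linear chain R G 0 -> R^o} :=
  lin_ext (chain_basis R G 0) (fun=> 1 : R^o).

Lemma chain_aug_delta z : chain_aug (chain_delta R z) = 1.
Proof. by rewrite /chain_aug /= lin_ext_chain // nondegenerate_singleton. Qed.

Lemma chain_boundary_equivariant n :
  equivariant (@chain_gact R G n.+1) (@chain_gact R G n) (@chain_boundary R G n).
Proof.
move=> g c.
have lg m := @chain_gact_linear R G m g.
apply: (chain_linear_eq (L := @chain_boundary R G n \o mk_linear (lg n.+1))
  (L' := mk_linear (lg n) \o @chain_boundary R G n)) => z nz.
rewrite [LHS]/= [RHS]/= chain_act_delta !chain_boundary_delta.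
rewrite -[RHS]/(mk_linear (lg n) _) linear_sum; apply: eq_bigr => j _.
by rewrite linearZ /= chain_act_delta face_gact.
Qed.

Lemma chain_aug_equivariant :
  equivariant (@chain_gact R G 0) (fun _ => id) chain_aug.
Proof.
move=> g c; have lg := @chain_gact_linear R G 0 g.
apply: (chain_linear_eq (L := chain_aug \o mk_linear lg) (L' := chain_aug)) => z nz.
by rewrite [LHS]/= chain_act_delta !chain_aug_delta.
Qed.

Lemma chain_aug_boundary (c : chain R G 1) : chain_aug (chain_boundary c) = 0.
Proof.
apply: (chain_linear_eq (L := chain_aug \o @chain_boundary R G 0) (L' := \0)) => z nz.
rewrite [LHS]/= chain_boundary_delta linear_sum.
rewrite !big_ord_recl big_ord0 !linearZ /= !chain_aug_delta.
by rewrite -![_ *: _]/(_ * _) expr0 expr1; ring.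
Qed.

(** The homotopy is the cone with apex 1: face 0 removes the apex, and the other faces are cones
    over the faces of [z] with shifted sign. In degree 0 the remaining face is the point (1), the
    image of [s]. *)
Lemma chain_contractible :
  exists (s : {linear R^o -> chain R G 0})
         (h : forall n, {linear chain R G n -> chain R G n.+1}),
      [/\ bounded_map s /\ forall n, bounded_map (h n),
          forall c, chain_aug (s c) = c,
          forall x, s (chain_aug x) + chain_boundary (h 0 x) = x &
          forall n x, h n (chain_boundary x) + chain_boundary (h n.+1 x) = x].
Proof.
pose e1 := chain_delta R [tuple (1%g : G)].
have ls : linear (fun c : R^o => c *: e1).
  by move=> a b c; rewrite scalerDl scalerA.
exists (mk_linear ls), chain_cone; split.
- by split=> [|n]; exact: fine_bounded_map.
- by move=> c; rewrite /= linearZ /= chain_aug_delta -[LHS]/(c * 1) mulr1.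
- move=> x; apply: (chain_linear_eq (L := (mk_linear ls \o chain_aug) \+
    (@chain_boundary R G 0 \o chain_cone 0)) (L' := idfun)) => z nz.
  rewrite [LHS]/= chain_aug_delta chain_cone_delta chain_boundary_delta scale1r.
  rewrite !big_ord_recl big_ord0 face_cons0 expr0 expr1 scale1r scaleN1r addr0.
  have -> : face (lift ord0 ord0) [tuple of 1%g :: z] = [tuple (1%g : G)].
    by apply: eq_from_tnth => i; rewrite (ord1 i) tnth_mktuple !(tnth_nth 1%g).
  by rewrite addrCA subrr addr0.
move=> n x; apply: (chain_linear_eq (L := (chain_cone n \o @chain_boundary R G n) \+
    (@chain_boundary R G n.+1 \o chain_cone n.+1)) (L' := idfun)) => z nz.
rewrite [LHS]/= chain_cone_delta !chain_boundary_delta linear_sum [X in _ + X]big_ord_recl.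
rewrite face_cons0 expr0 scale1r addrCA -[RHS]addr0; congr (_ + _).
rewrite -big_split big1 // => j _ /=.
by rewrite face_consS linearZ /= chain_cone_delta /bump /= exprS mulN1r scaleNr subrr.
Qed.

Definition chain_resolution : projective_resolution R G :=
  @ProjectiveResolution R G (chain R G) (@chain_gact R G) (@chain_is_gmodule R G)
    (@chain_relatively_projective R G) (@chain_boundary R G) (@chain_boundary_bounded R G)
    (@chain_boundary_equivariant) (@chain_boundary_boundary R G)
    chain_aug (fun A h => @fine_bounded_map _ _ _ chain_aug (fun _ h => h) A h)
    chain_aug_equivariant chain_aug_boundary chain_contractible.

Lemma res_aug_equivariant (P : free_resolution R G) :
  equivariant (fun g => res_act P 0 (galg_delta R g)) (fun _ => id) (res_aug P).
Proof. by move=> g x; rewrite res_aug_act galg_aug_delta mul1r. Qed.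

Lemma res_relatively_projective (P : free_resolution R G) n :
  relatively_projective (fun g => res_act P n (galg_delta R g)).
Proof.
apply: free_relatively_projective; last exact: res_free.
by have [] := res_actP P n.
Qed.

Definition free_projective_resolution (P : free_resolution R G) :
    projective_resolution R G :=
  @ProjectiveResolution R G (res_obj P) (fun n g => res_act P n (galg_delta R g))
    (fun n => action_is_gmodule (res_actP P n)) (@res_relatively_projective P)
    (res_d P) (@res_d_bounded R G P) (fun n g x => @res_d_act R G P n (galg_delta R g) x)
    (@res_dd R G P) (res_aug P) (@res_aug_bounded R G P) (@res_aug_equivariant P)
    (@res_aug_d R G P) (res_contractible P).

End ChainResolution.

(** * The balanced tensor product *)

(** Limits in a complete target are unique: the image of the bounded set lies in a ball of a Banach
    space, where the preimage of [f l], unique by injectivity, has norm at most [|e n| * r] for all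
    n. *)
Lemma kernel_closed (R : realType) (V : bornType R) (E : cbornType R)
    (f : {linear V -> E}) : bounded_map f -> closed_subspace [set x | f x = 0].
Proof.
move=> bf; split=> [|a x y /= fx fy|u l /= fu [A hA [e e0 ul]]].
- exact: linear0.
- by rewrite linearP fx fy scaler0 addr0.
have [B [i [inj_i _ [r Ar]]]] := born_complete _ (bf _ hA).
have H n : exists2 c : B, f l = i c & `|c| <= `|e n| * r.
  have [x Ax ux] := ul n; have [b /= br ib] := Ar (f x) (ex_intro2 _ _ x Ax erefl).
  exists (- (e n *: b)); last by rewrite normrN normrZ ler_wpM2l.
  by rewrite linearN linearZ ib -linearZ -ux linearB fu sub0r opprK.
have [c fl _] := H 0%N; rewrite fl; suff -> : c = 0 by rewrite linear0.
apply/eqP; rewrite -normr_le0.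
have er : (fun n => `|e n| * r) @ \oo --> (0 : R).
  rewrite -[X in _ --> X](mul0r r); apply: cvgM; last exact: cvg_cst.
  by rewrite -(@normr0 _ R); apply: cvg_norm.
apply: (closed_cvg (fun x : R => `|c| <= x)) er; first exact: closed_ge.
apply: nearW => n; have [c' fl' cn] := H n.
by have -> : c = c' by apply: inj_i; rewrite -fl -fl'.
Qed.

Section BalancedUniversal.
Variables (R : realType) (G : groupType) (S : generating_seq G) (t : decay R).
Local Notation TG := (decay_space S t).

Definition balanced (M : Type) (act : G -> M -> M) (Z : Type) (b : TG -> M -> Z) : Prop :=
  forall phi g m, b (decay_mulg phi g) m = b phi (act g m).

(** The universal property freed from its construction as a quotient, so that TC_n can satisfy it
    too. *)
Record is_balanced_tensor (M : bornType R) (act : G -> M -> M) (Z : cbornType R)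
    (tens : {bilinear TG -> M -> Z}) : Prop := IsBalancedTensor {
  bal_bounded : bounded_map2 tens;
  bal_balanced : balanced act tens;
  bal_ext : forall (E : cbornType R) (b : {bilinear TG -> M -> E}),
    bounded_map2 b -> balanced act b ->
    exists2 f : {linear Z -> E}, bounded_map f & forall phi m, f (tens phi m) = b phi m;
  bal_uniq : forall (E : cbornType R) (f f' : {linear Z -> E}),
    bounded_map f -> bounded_map f' ->
    (forall phi m, f (tens phi m) = f' (tens phi m)) -> f =1 f' }.

Lemma balanced_tensor_map (M M' : bornType R) (act : G -> M -> M) (act' : G -> M' -> M')
    (Z Z' : cbornType R) (tens : {bilinear TG -> M -> Z}) (tens' : {bilinear TG -> M' -> Z'})
    (h : {linear M -> M'}) :
  is_balanced_tensor act tens -> is_balanced_tensor act' tens' ->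
  bounded_map h -> equivariant act act' h ->
  exists2 f : {linear Z -> Z'}, bounded_map f &
    forall phi m, f (tens phi m) = tens' phi (h m).
Proof.
move=> tensP tens'P bh eh; pose b phi m := tens' phi (h m).
have lb : bilinear_for *:%R *:%R b.
  by split=> [m a phi psi|phi a m m']; rewrite /b ?linearPl // linearP linearPr.
have bb : bounded_map2 (mk_bilinear lb).
  move=> A B hA /bh hB; have := bal_bounded tens'P hA hB; apply: born_subset.
  move=> _ [phi Aphi [m Bm <-]]; exists phi => //; exists (h m) => //; by exists m.
apply: (bal_ext tensP bb) => phi g m /=.
by rewrite /b (bal_balanced tens'P) eh.
Qed.

Lemma bt_class_bilinear (M : bornType R) (act : G -> M -> M) (Q : balanced_tensor S t act) :
  bilinear_for *:%R *:%R (bt_class Q).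
Proof.
by split=> [m a phi psi|phi a m m']; rewrite /bt_class ?linearPl ?linearPr linearP.
Qed.

(** An extension to the full tensor product kills the balancing relations, hence their closed span
    by [kernel_closed]. It descends through any choice of preimages and stays bounded because
    bounded sets of the quotient are images of bounded sets. *)
Lemma bt_is_balanced_tensor (M : bornType R) (act : G -> M -> M)
    (Q : balanced_tensor S t act) :
  is_balanced_tensor act (mk_bilinear (bt_class_bilinear Q)).
Proof.
have [sq kq bq] := bt_projP Q.
have bp : bounded_map (bt_proj Q) by move=> A hA; apply/bq; exists A.
split.
- move=> A B hA hB; have := bp _ ((bt_tensP Q).1 _ _ hA hB); apply: born_subset.
  move=> _ [phi Aphi [m Bm <-]]; exists (bt_tens Q phi m) => //.
  by exists phi => //; exists m.
- move=> phi g m /=; apply/eqP; rewrite -subr_eq0 -linearB; apply/eqP/kq.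
  by move=> N _; apply; exists phi, g, m.
- move=> E b bb balb; have [f0 [bf0 f0E _]] := (bt_tensP Q).2 E b bb.
  have f0ker x : bt_proj Q x = 0 -> f0 x = 0.
    move=> /kq /(_ [set x | f0 x = 0]); apply; first exact: kernel_closed.
    by move=> _ [phi [g [m ->]]] /=; rewrite linearB !f0E balb subrr.
  have f0eq x y : bt_proj Q x = bt_proj Q y -> f0 x = f0 y.
    move=> xy; apply/eqP; rewrite -subr_eq0 -linearB; apply/eqP/f0ker.
    by rewrite linearB xy subrr.
  have [s sK] := choice sq.
  have lf : linear (f0 \o s).
    by move=> a x y; rewrite /= -linearP; apply: f0eq; rewrite linearP !sK.
  exists (mk_linear lf) => [B /bq[A hA ->]|phi m].
    apply: born_subset (bf0 _ hA) => _ [_ [x Ax <-] <-]; exists x => //=.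
    by apply: f0eq; rewrite sK.
  by rewrite /= -f0E; apply: f0eq; rewrite sK.
- move=> E f f' bf bf' ff' x; apply/eqP; rewrite -subr_eq0; apply/eqP.
  apply: (bt_class_eq0 (f := f \- f')) => [|phi m]; last first.
    by have /= -> := ff' phi m; rewrite subrr.
  have := bounded_lin (- 1) bf' bf; congr bounded_map; apply/funext => y /=.
  by rewrite scaleN1r addrC.
Qed.

Section Homotopy.
Variables (X Y : projective_resolution R G) (ZX ZY : nat -> cbornType R).
Variables (tX : forall n, {bilinear TG -> X n -> ZX n}).
Variables (tY : forall n, {bilinear TG -> Y n -> ZY n}).
Hypothesis tXP : forall n, is_balanced_tensor (@pr_act _ _ X n) (tX n).
Hypothesis tYP : forall n, is_balanced_tensor (@pr_act _ _ Y n) (tY n).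
Variables (dX : forall n, {linear ZX n.+1 -> ZX n}) (dY : forall n, {linear ZY n.+1 -> ZY n}).
Hypothesis dXb : forall n, bounded_map (dX n).
Hypothesis dYb : forall n, bounded_map (dY n).
Hypothesis dXE : forall n phi m, dX n (tX n.+1 phi m) = tX n phi (pr_d X n m).
Hypothesis dYE : forall n phi m, dY n (tY n.+1 phi m) = tY n phi (pr_d Y n m).

Lemma induced_chain_map (f : forall n, {linear X n -> Y n}) :
  (forall n, bounded_map (f n)) ->
  (forall n, equivariant (@pr_act _ _ X n) (@pr_act _ _ Y n) (f n)) ->
  (forall n x, f n (pr_d X n x) = pr_d Y n (f n.+1 x)) ->
  exists F : forall n, {linear ZX n -> ZY n},
    [/\ forall n, bounded_map (F n), forall n x, F n (dX n x) = dY n (F n.+1 x) &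
        forall n phi m, F n (tX n phi m) = tY n phi (f n m)].
Proof.
move=> bf ef fd.
have H n := balanced_tensor_map (tXP n) (tYP n) (bf n) (ef n).
pose F n := sval (cid2 (H n)).
have bF n : bounded_map (F n) by rewrite /F; case: cid2.
have FE n phi m : F n (tX n phi m) = tY n phi (f n m) by rewrite /F; case: cid2.
exists F; split=> // n.
apply: (bal_uniq (tXP n.+1) (f := F n \o dX n) (f' := dY n \o F n.+1)).
- exact: bounded_comp.
- exact: bounded_comp.
- by move=> phi m /=; rewrite dXE !FE dYE fd.
Qed.

Lemma induced_homotopy (u : forall n, ZX n -> ZX n) (u0 : forall n, X n -> X n)
    (H : forall n, {linear X n -> X n.+1}) (bu : forall n, bounded_map (u n))
    (lu : forall n, linear (u n)) :
  (forall n phi m, u n (tX n phi m) = tX n phi (u0 n m)) ->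
  (forall n, bounded_map (H n)) ->
  (forall n, equivariant (@pr_act _ _ X n) (@pr_act _ _ X n.+1) (H n)) ->
  (forall x, u0 0%N x - x = pr_d X 0 (H 0%N x)) ->
  (forall n x, u0 n.+1 x - x = pr_d X n.+1 (H n.+1 x) + H n (pr_d X n x)) ->
  exists h : forall n, {linear ZX n -> ZX n.+1},
    [/\ forall n, bounded_map (h n),
        forall x, u 0%N x - x = dX 0 (h 0%N x) &
        forall n x, u n.+1 x - x = dX n.+1 (h n.+1 x) + h n (dX n x)].
Proof.
move=> uE bH eH H0 HS.
have ex n := balanced_tensor_map (tXP n) (tXP n.+1) (bH n) (eH n).
pose h n := sval (cid2 (ex n)).
have bh n : bounded_map (h n) by rewrite /h; case: cid2.
have hE n phi m : h n (tX n phi m) = tX n.+1 phi (H n m) by rewrite /h; case: cid2.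
have bu1 n : bounded_map (mk_linear (lu n) \- idfun).
  have := bounded_lin (- 1) (@bounded_id R (ZX n)) (bu n).
  by congr bounded_map; apply/funext => x /=; rewrite scaleN1r addrC.
have uB n phi m : u n (tX n phi m) - tX n phi m = tX n phi (u0 n m - m).
  by rewrite uE linearBr.
exists h; split=> // [|n].
  apply: (bal_uniq (tXP 0) (f := mk_linear (lu 0%N) \- idfun) (f' := dX 0 \o h 0%N)) => //.
    exact: bounded_comp.
  by move=> phi m /=; rewrite uB hE dXE H0.
apply: (bal_uniq (tXP n.+1) (f := mk_linear (lu n.+1) \- idfun)
  (f' := (dX n.+1 \o h n.+1) \+ (h n \o dX n))) => //.
  have := bounded_lin 1 (bounded_comp (@dXb n.+1) (bh n.+1)) (bounded_comp (bh n) (@dXb n)).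
  by congr bounded_map; apply/funext => x /=; rewrite scale1r.
by move=> phi m /=; rewrite uB !hE !dXE hE -linearDr HS.
Qed.

End Homotopy.

Lemma balanced_homotopy_equivalent (X Y : projective_resolution R G)
    (ZX ZY : nat -> cbornType R)
    (tX : forall n, {bilinear TG -> X n -> ZX n}) (tY : forall n, {bilinear TG -> Y n -> ZY n})
    (dX : forall n, {linear ZX n.+1 -> ZX n}) (dY : forall n, {linear ZY n.+1 -> ZY n})
    (dXb : forall n, bounded_map (dX n)) (dYb : forall n, bounded_map (dY n))
    (dXX : forall n x, dX n (dX n.+1 x) = 0) (dYY : forall n x, dY n (dY n.+1 x) = 0) :
  (forall n, is_balanced_tensor (@pr_act _ _ X n) (tX n)) ->
  (forall n, is_balanced_tensor (@pr_act _ _ Y n) (tY n)) ->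
  (forall n phi m, dX n (tX n.+1 phi m) = tX n phi (pr_d X n m)) ->
  (forall n phi m, dY n (tY n.+1 phi m) = tY n phi (pr_d Y n m)) ->
  homotopy_equivalent (BornComplex dXb dXX) (BornComplex dYb dYY).
Proof.
move=> tXP tYP dXE dYE.
have [f [bf ef af fd]] := exists_chain_map X Y.
have [g [bg eg ag gd]] := exists_chain_map Y X.
have [F [bF Fd FE]] := induced_chain_map tXP tYP dXb dYb dXE dYE bf ef fd.
have [K [bK Kd KE]] := induced_chain_map tYP tXP dYb dXb dYE dXE bg eg gd.
have [HX [bHX eHX HX0 HXS]] := resolutions_homotopic bf bg ef eg af ag fd gd.
have [HY [bHY eHY HY0 HYS]] := resolutions_homotopic bg bf eg ef ag af gd fd.
exists F, K; split; [by []|by []| |].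
  apply: (induced_homotopy tXP dXb dXE (u := fun n => K n \o F n) _ _ _ bHX eHX HX0 HXS).
  - by move=> n; exact: bounded_comp.
  - by move=> n; exact: linearP.
  - by move=> n phi m /=; rewrite FE KE.
apply: (induced_homotopy tYP dYb dYE (u := fun n => F n \o K n) _ _ _ bHY eHY HY0 HYS).
- by move=> n; exact: bounded_comp.
- by move=> n; exact: linearP.
- by move=> n phi m /=; rewrite KE FE.
Qed.

End BalancedUniversal.

(** * Decay chains as a balanced tensor product *)

Section DecayPush.
Variables (R : realType) (G : groupType) (S : generating_seq G) (t : decay R).
Local Notation TG := (decay_space S t).

(** Right translation by [h] moves each point by the distance l(h) in the left invariant metric, so
    weights change by a bounded factor. *)
Lemma weighted_norm_translate w (h : G) : is_weight S w -> exists2 C : R, 0 <= C &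
  forall f : G -> R, (weighted_norm w (fun x => (f (x * h^-1)%g)%:E) <=
    C%:E * weighted_norm w (EFin \o f))%E.
Proof.
move=> Ww; have [C C0 hC] := weight_comp (word_length S h) Ww.
exists C => // f.
have gb : bijective (fun x => x * h)%g.
  by exists (fun x => x * h^-1)%g => x; rewrite ?mulgK ?mulgVK.
rewrite /weighted_norm (@reindex_esum _ _ _ setT setT (fun x => x * h)%g); last first.
  by rewrite setTT_bijective.
rewrite -esumZl // => [|x]; last by rewrite mule_ge0 ?lee_fin ?(weight_ge0 _ Ww).
apply: le_esum => x _; rewrite /= mulgK -!EFinM lee_fin.
by rewrite mulrCA ler_wpM2l // hC // /word_dist mulKg.
Qed.

Lemma diameter_gact r n g (z : n.-tuple G) : diameter_le S r z -> diameter_le S r (gact g z).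
Proof. by move=> h i j; rewrite !tnth_map /word_dist invgM -mulgA mulKg; exact: h. Qed.

Lemma diameter_ex n (z : n.-tuple G) : exists r, diameter_le S r z.
Proof.
exists (\max_(p : 'I_n * 'I_n) word_dist S (tnth z p.1) (tnth z p.2)) => i j.
exact: (leq_bigmax (i, j)).
Qed.

(** The orbit of [z] contains exactly one tuple with first entry [x], so the sum has at most one
    nonzero term. *)
Lemma marginal_push n (phi : G -> R) (z : n.+1.-tuple G) x :
  (marginal (push phi z) x <= `|phi (x * (thead z)^-1)%g|%:E)%E.
Proof.
apply/ge0_esum_leP => // s us; set g := (x * (thead z)^-1)%g.
pose y0 : n.-tuple G := [tuple of behead (gact g z)].
have P (y : n.-tuple G) : push phi z [tuple of x :: y] != 0 -> y = y0.
  rewrite /push theadE; case: ifP => [/andP[_ /eqP yz] _|]; last by rewrite eqxx.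
  by apply: val_inj => /=; move/(congr1 val): yz => /= <-.
have [ys|ys] := boolP (y0 \in s).
  rewrite (bigD1_seq y0) //= big1 ?addr0.
    by rewrite /push theadE; case: ifP => // _; rewrite normr0.
  by move=> y /negP yy0; apply/eqP; rewrite normr_eq0; apply: contraPT yy0 => /P ->; rewrite eqxx.
rewrite big_seq big1 // => y yin; apply/eqP; rewrite normr_eq0.
by apply: contraNT ys => /P <-.
Qed.

Lemma chain_bounded_push n (z : n.+1.-tuple G) (A : set (G -> R)) :
  decay_bounded S t [set EFin \o f | f in A] -> chain_bounded S t [set push f z | f in A].
Proof.
move=> hA; have [r hr] := diameter_ex z; exists r.
  move=> _ [f Af <-] w; rewrite /push; case: ifP => [/andP[nw /eqP wz] _|]; last by rewrite eqxx.
  by split=> //; rewrite wz; exact: diameter_gact.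
apply: decay_bounded1 hA => w Ww; have [C C0 hC] := weighted_norm_translate (thead z) Ww.
apply: (@norm_bounded_dom _ _ S w _ _ C) => // _ [_ [f Af <-] <-].
exists (EFin \o f); first by exists f.
apply: le_trans (hC f); apply: (le_weighted_norm Ww) => x.
by rewrite gee0_abs ?marginal_ge0 // marginal_push.
Qed.

Lemma push_in n (z : n.+1.-tuple G) (phi : TG) : push phi z \in @in_decay_chain R G S t n.
Proof.
apply/asboolP; have /asboolP := decay_valP phi.
by move=> /(@chain_bounded_push n z); rewrite image_set1.
Qed.

Definition decay_push n (z : n.+1.-tuple G) (phi : TG) : decay_chain S t n :=
  DecayChain (push_in z phi).

Lemma decay_push_linear n (z : n.+1.-tuple G) : linear (decay_push z).
Proof. by move=> a phi psi; apply: val_inj; exact: push_linear. Qed.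

Lemma decay_push_bounded n (z : n.+1.-tuple G) : bounded_map (decay_push z).
Proof.
move=> A hA; have := chain_bounded_push z hA; apply: chain_bounded_subset.
by move=> _ [_ [phi Aphi <-] <-]; exists (phi : G -> R) => //; exists phi.
Qed.

Lemma decay_push0 n (z : n.+1.-tuple G) phi : ~~ nondegenerate z -> decay_push z phi = 0.
Proof. by move=> nz; apply: val_inj; rewrite /= push_degenerate. Qed.

Definition decay_tensor n (phi : TG) (c : chain R G n) : decay_chain S t n :=
  lin_ext (chain_basis R G n) (fun z => decay_push z phi) c.

Lemma decay_tensor_bilinear n : bilinear_for *:%R *:%R (@decay_tensor n).
Proof.
split=> [c|phi]; last exact: lin_ext_linear.
by apply: lin_ext_linear_param => z; exact: decay_push_linear.
Qed.

Definition decay_tens n : {bilinear TG -> chain R G n -> decay_chain S t n} :=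
  mk_bilinear (@decay_tensor_bilinear n).

Lemma decay_tens_delta n phi (z : n.+1.-tuple G) :
  decay_tens n phi (chain_delta R z) = decay_push z phi.
Proof.
have [nz|nz] := boolP (nondegenerate z); first exact: lin_ext_chain.
by rewrite chain_delta0 // decay_push0 // linear0r.
Qed.

Lemma decay_tens_bounded n : bounded_map2 (decay_tens n).
Proof.
apply: fine_bounded_map2 => [A //|phi|c]; first exact: lin_ext_linear.
by apply: lin_ext_bounded_param => z; exact: decay_push_bounded.
Qed.

Lemma decay_tens_boundary n phi (c : chain R G n.+1) :
  decay_chain_boundary (decay_tens n.+1 phi c) = decay_tens n phi (chain_boundary c).
Proof.
have l1 : linear (fun c => decay_chain_boundary (decay_tens n.+1 phi c)).
  by move=> a u v; rewrite linearPr linearP.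
have l2 : linear (fun c : chain R G n.+1 => decay_tens n phi (chain_boundary c)).
  by move=> a u v; rewrite linearP linearPr.
apply: (chain_linear_eq (L := mk_linear l1) (L' := mk_linear l2)) => z nz.
rewrite -[LHS]/(decay_chain_boundary (decay_tens n.+1 phi (chain_delta R z))).
rewrite -[RHS]/(decay_tens n phi (chain_boundary (chain_delta R z))).
rewrite decay_tens_delta chain_boundary_delta linear_sumr.
apply: val_inj; rewrite linear_sum -[LHS]/(boundary (push phi z)) boundary_push //.
by apply: eq_bigr => j _; rewrite linearZr_LR decay_tens_delta.
Qed.

Lemma decay_mulgE (phi : TG) g x : decay_mulg phi g x = phi (x * g^-1)%g.
Proof. exact: convolution_gdelta. Qed.

Lemma decay_push_gact n (z : n.+1.-tuple G) g phi :
  decay_push z (decay_mulg phi g) = decay_push (gact g z) phi.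
Proof.
apply: val_inj; apply/funext => w.
rewrite -[LHS]/(push (decay_mulg phi g) z w) -[RHS]/(push phi (gact g z) w).
rewrite /push decay_mulgE.
rewrite thead_gact invgM mulgA; congr (if _ && _ then _ else _).
congr (_ == _); apply: eq_from_tnth => i; rewrite !tnth_map.
by rewrite -!mulgA mulKg.
Qed.

Lemma decay_tens_balanced n : balanced (@chain_gact R G n) (decay_tens n).
Proof.
move=> phi g c.
have lg := @chain_gact_linear R G n g.
have l2 : linear (fun c => decay_tens n phi (chain_gact g c)).
  by move=> a u v; rewrite lg linearPr.
have l1 := decay_tensor_bilinear n.
apply: (chain_linear_eq (L := mk_linear (l1.2 (decay_mulg phi g))) (L' := mk_linear l2)) => z nz.
rewrite -[LHS]/(decay_tens n (decay_mulg phi g) (chain_delta R z)).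
rewrite -[RHS]/(decay_tens n phi (chain_gact g (chain_delta R z))).
by rewrite chain_act_delta !decay_tens_delta decay_push_gact.
Qed.

Lemma decay_tens_convolution n (phi : TG) (c : chain R G n) :
  decay_chain_val (decay_tens n phi c) = convolution (@gact G n.+1) phi c.
Proof.
have [s us hs] := fb_support (chain_basis R G n) c.
apply/funext => w.
have -> : decay_chain_val (decay_tens n phi c) w = \sum_(z <- s) c z * push phi z w.
  rewrite -[decay_tens n phi c]/(lin_ext _ _ _) (lin_extE _ us hs) -[decay_chain_val _]/(val _).
  by rewrite linear_sum fct_sumE.
rewrite /convolution; have [nw|nw] := boolP (nondegenerate w); last first.
  rewrite big1 => [|z _]; last by rewrite /push (negbTE nw) mulr0.
  by rewrite fsbig1 // => g _; rewrite chain_degenerate ?mulr0 // nondegenerate_gact.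
(* Only g = [q z] can satisfy w = g z, and then z = g^-1 w is recovered from g. This turns the sum
   over chain points into the sum over group elements. *)
pose q (z : n.+1.-tuple G) := (thead w * (thead z)^-1)%g.
pose s' := [seq z <- s | w == gact (q z) z].
have us' : uniq [seq q z | z <- s'].
  rewrite map_inj_in_uniq ?filter_uniq // => z z'.
  rewrite !mem_filter => /andP[/eqP wz _] /andP[/eqP wz' _] qq.
  by rewrite -(gactK (q z) z) -wz qq {1}wz' gactK.
rewrite -(@fsbig_widen _ _ _ _ [set` [seq q z | z <- s']]) //; last first.
  move=> g [_ /= ng]; apply/eqP; rewrite mulf_eq0; apply/orP; right.
  apply: contra_notT ng => cg; apply/mapP; exists (gact g^-1%g w).
    rewrite mem_filter hs // andbT /q thead_gact invgM invgK mulVKg gactVK.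
    by [].
  by rewrite /q thead_gact invgM invgK mulVKg.
rewrite -fsbig_seq // [RHS]big_map [RHS]big_filter [RHS]big_mkcond; apply: eq_bigr => z _ /=.
rewrite /push nw /= -/(q z); case: eqP => [wz|_]; last by rewrite mulr0.
by rewrite mulrC wz gactK.
Qed.

End DecayPush.

Lemma finite_tuples (T : choiceType) (Y : set T) n : finite_set Y ->
  finite_set [set z : n.-tuple T | forall i, Y (tnth z i)].
Proof.
move=> fY; elim: n => [|n IH].
  by apply: sub_finite_set (finite_set1 [tuple]) => z _; rewrite /= tuple0.
have := finite_image2 (fun x (z : n.-tuple T) => [tuple of x :: z]) fY IH.
apply: sub_finite_set => z hz; exists (thead z); first exact: hz.
exists [tuple of behead z]; last by rewrite -tuple_eta.
by move=> i /=; rewrite tnth_behead; exact: hz.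
Qed.

(** * Decomposition of decay chains along orbits *)

Section DecaySlices.
Variables (R : realType) (G : groupType) (S : generating_seq G) (t : decay R) (n : nat).
Local Notation TG := (decay_space S t).
Local Notation base y := [tuple of 1%g :: (y : n.-tuple G)].

(* The values of f along the orbit of (1, y); every tuple lies in exactly one
   such orbit. *)
Definition slice (f : n.+1.-tuple G -> R) (y : n.-tuple G) : G -> R :=
  fun x => f (gact x (base y)).

Lemma slice_marginal (f : n.+1.-tuple G -> R) y x :
  (`|slice f y x|%:E <= marginal f x)%E.
Proof.
apply: ereal_sup_ubound; exists [set gact x y] => //.
rewrite fsbig_set1 /slice; congr (`|f _|%:E).
by apply: val_inj; rewrite /= mulg1.
Qed.

Lemma decay_bounded_slice y (A : set (n.+1.-tuple G -> R)) :
  decay_bounded S t [set marginal f | f in A] ->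
  decay_bounded S t [set EFin \o slice f y | f in A].
Proof.
apply: decay_bounded1 => w Ww; apply: (@norm_bounded_dom _ _ S w _ _ 1) => //.
move=> _ [f Af <-]; exists (marginal f); first by exists f.
rewrite mul1e; apply: (le_weighted_norm Ww) => x.
by rewrite [leRHS]gee0_abs ?marginal_ge0 // slice_marginal.
Qed.

Lemma slice_in (f : decay_chain S t n) y : slice f y \in in_decay S t.
Proof.
apply/asboolP; have /asboolP[r _ hf] := decay_chain_valP f.
rewrite image_set1; have := decay_bounded_slice y hf; by rewrite image_set1.
Qed.

Definition decay_slice (y : n.-tuple G) (f : decay_chain S t n) : TG :=
  DecaySpace (slice_in f y).

Lemma decay_slice_linear y : linear (decay_slice y).
Proof. by move=> a f g; apply: val_inj; apply/funext. Qed.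

Lemma decay_slice_bounded y : bounded_map (decay_slice y).
Proof.
move=> A [r _ hA]; have := decay_bounded_slice y hA; apply: sub_decay_bounded.
by move=> _ [_ [_ [f Af <-] <-] <-]; exists (f : _ -> R) => //; exists f.
Qed.

(** Only the orbit of [z] contributes. There z = g (1, y) with g = [thead z], so pushing [phi] along
    z is pushing phi * delta_g along (1, y). *)
Lemma decay_slice_push y (z : n.+1.-tuple G) (phi : TG) : nondegenerate z ->
  decay_slice y (decay_push z phi) =
  if gact (thead z)^-1%g z == base y then decay_mulg phi (thead z) else 0.
Proof.
move=> nz; have th x : thead (gact x (base y)) = x by rewrite thead_gact theadE mulg1.
apply: val_inj; apply/funext => x; rewrite -[LHS]/(push phi z (gact x (base y))).
have E x' w : gact x' (base y) = gact w z -> w = (x' * (thead z)^-1)%g.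
  by move=> /(congr1 (@thead _ _)); rewrite th thead_gact => ->; rewrite mulgK.
case: (gact (thead z)^-1%g z =P base y) => [zy|nzy].
  rewrite -[RHS]/(decay_mulg phi (thead z) x) decay_mulgE -(push_gact phi _ nz).
  congr push; rewrite -zy; apply: eq_from_tnth => i; rewrite !tnth_map.
  by rewrite mulgA.
apply: push_eq0 => w xw; apply: nzy; have wE := E _ _ xw.
have : gact x^-1%g (gact x (base y)) = gact x^-1%g (gact w z) by rewrite xw.
rewrite gactK => ->; apply: eq_from_tnth => i; rewrite !tnth_map wE.
by rewrite -!mulgA mulKg.
Qed.

(** As the first entry is 1, the diameter bounds the word length of every entry of [y], and balls
    are finite. *)
Lemma finite_slices r : exists2 s : seq (n.-tuple G), uniq s &
  forall y : n.-tuple G, diameter_le S r (base y) -> y \in s.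
Proof.
have : finite_set [set y : n.-tuple G | diameter_le S r (base y)].
  apply: sub_finite_set (finite_tuples n (finite_ball S r)) => y hy i /=.
  have := hy ord0 (lift ord0 i).
  by rewrite /word_dist tnth0 invg1 mul1g tnthS.
move=> /finite_seqP[s hs]; exists (undup s); first exact: undup_uniq.
by move=> y yr; rewrite mem_undup; have : [set` s] y by rewrite -hs.
Qed.

Lemma slice_eq0 r (f : decay_chain S t n) y : chain_supported S r f ->
  ~ diameter_le S r (base y) -> decay_slice y f = 0.
Proof.
move=> fr nd; apply: val_inj; apply/funext => x /=; apply/eqP.
rewrite /slice; apply: contra_notT nd => /fr[_ dx].
by have := diameter_gact x^-1%g dx; rewrite gactK.
Qed.

Lemma chain_supported_le r r' (f : n.+1.-tuple G -> R) : (r <= r')%N ->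
  chain_supported S r f -> chain_supported S r' f.
Proof. by move=> rr fr z /fr[nz dz]; split=> // i j; exact: leq_trans (dz i j) rr. Qed.

Lemma decay_chain_expand r (f : decay_chain S t n) (s : seq (n.-tuple G)) :
  chain_supported S r f -> uniq s -> (forall y : n.-tuple G, diameter_le S r (base y) -> y \in s) ->
  f = \sum_(y <- s) decay_tens S t n (decay_slice y f) (chain_delta R (base y)).
Proof.
move=> fr us hs; apply: val_inj; rewrite linear_sum; apply/funext => w.
(* [y0] is the only index whose orbit contains [w]. *)
rewrite fct_sumE; pose y0 : n.-tuple G := [tuple of behead (gact (thead w)^-1%g w)].
have wy0 : gact (thead w) (base y0) = w.
  apply: val_inj; rewrite -[w in RHS](gactVK (thead w)) [in RHS](tuple_eta (gact _ w)) /=.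
  by rewrite thead_gact mulVg.
have E y : val (decay_tens S t n (decay_slice y f) (chain_delta R (base y))) w =
    if (y == y0) && nondegenerate w then f w else 0.
  rewrite decay_tens_delta -[LHS]/(push (slice f y) (base y) w).
  case: (y =P y0) => [->|ny] /=.
    have [nw|nw] := boolP (nondegenerate w); last by rewrite /push (negbTE nw).
    have nb : nondegenerate (base y0) by rewrite -(nondegenerate_gact (thead w)) wy0.
    have := push_gact (slice f y0) (thead w) nb.
    by rewrite wy0 => ->; exact: (congr1 (decay_chain_val f) wy0).
  apply: push_eq0 => g wg; apply: ny; apply: val_inj.
  have yw : gact (thead w)^-1%g w = base y.
    by rewrite wg thead_gact theadE mulg1 gactK.
  by rewrite -[RHS]/(behead (val (gact (thead w)^-1%g w))) yw.
rewrite [RHS](eq_bigr (fun y => if (y == y0) && nondegenerate w then f w else 0));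
  last by move=> y _; exact: E.
have [fw|fw] := eqVneq (decay_chain_val f w) 0.
  by rewrite [LHS]fw big1 // => y _; rewrite fw; case: ifP.
have [nw dw] := fr w fw.
have y0s : y0 \in s.
  apply: hs; have := diameter_gact (thead w)^-1%g dw.
  by rewrite -{2}wy0 gactK.
rewrite (bigD1_seq y0) //= eqxx nw big1 ?addr0 //.
by move=> y /negbTE ->.
Qed.

End DecaySlices.

Lemma bounded_sum (R : realType) (U V : bornType R) (I : Type) (s : seq I) (F : I -> U -> V) :
  (forall i, bounded_map (F i)) -> bounded_map (fun u => \sum_(i <- s) F i u).
Proof.
move=> bF; elim: s => [|i s IH].
  move=> A _; apply: born_subset (born_finite _ (finite_set1 0)).
  by move=> _ [u _ <-]; rewrite big_nil.
have := bounded_lin 1 (bF i) IH; congr bounded_map; apply/funext => u.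
by rewrite big_cons scale1r.
Qed.

(** * Universal property of the decay chains *)

Section DecayUniversal.
Variables (R : realType) (G : groupType) (S : generating_seq G) (t : decay R).
Local Notation TG := (decay_space S t).

Lemma decay_tens_is_balanced_tensor n :
  is_balanced_tensor (@chain_gact R G n) (decay_tens S t n).
Proof.
split.
- exact: decay_tens_bounded.
- exact: decay_tens_balanced.
- move=> E b bb balb.
  pose e (y : n.-tuple G) := chain_delta R [tuple of 1%g :: y].
  (* Summing over all [y] avoids choosing a diameter bound for [f]; [betaE] shows that the support
     is finite and computes the sum over any sufficiently large list. *)
  pose beta (f : decay_chain S t n) : E :=
    \sum_(y \in [set: n.-tuple G]) b (decay_slice y f) (e y).
  have betaE r s (f : decay_chain S t n) : uniq s ->
      (forall y : n.-tuple G, diameter_le S r [tuple of 1%g :: y] -> y \in s) ->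
      chain_supported S r f -> beta f = \sum_(y <- s) b (decay_slice y f) (e y).
    move=> us hs fr; rewrite /beta -(@fsbig_widen _ _ _ _ [set` s]) //.
      exact/esym/fsbig_seq.
    move=> y [_ /= ys]; rewrite (slice_eq0 fr) ?linear0l // => yr.
    by apply: ys; exact: hs.
  have lbeta : linear beta.
    move=> a f g.
    have /asboolP[r fr _] := decay_chain_valP f; have /asboolP[r' gr _] := decay_chain_valP g.
    have {}fr := fr _ erefl; have {}gr := gr _ erefl.
    have [s us hs] := @finite_slices G S n (maxn r r').
    rewrite !(betaE (maxn r r') s) //.
    + rewrite scaler_sumr -big_split; apply: eq_bigr => y _ /=.
      by rewrite decay_slice_linear linearPl.
    + exact: chain_supported_le (leq_maxr _ _) gr.
    + exact: chain_supported_le (leq_maxl _ _) fr.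
    + exact: chain_supported_lin.
  exists (mk_linear lbeta) => [A hA|phi c].
    (* One diameter bound for the whole of [A] gives one finite list, so on [A] the map is a fixed
       finite sum of bounded maps. *)
    have [r hr _] := hA; have [s us hs] := @finite_slices G S n r.
    have bs y : bounded_map (fun f : decay_chain S t n => b (decay_slice y f) (e y)).
      move=> B hB; have := bb _ _ (decay_slice_bounded y hB)
        (born_finite _ (finite_set1 (e y))).
      apply: born_subset => _ [f Bf <-]; exists (decay_slice y f); first by exists f.
      by exists (e y).
    have := bounded_sum s bs hA; apply: born_subset => _ [f Af <-]; exists f => //.
    by rewrite /= (betaE r s) //; apply: hr; exists f.
  have lL : linear (fun c => beta (decay_tens S t n phi c)).
    by move=> a u v; rewrite linearPr lbeta.
  have lR : linear (fun c => b phi c) by move=> a u v; rewrite linearPr.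
  apply: (chain_linear_eq (L := mk_linear lL) (L' := mk_linear lR)) => z nz.
  rewrite -[LHS]/(beta (decay_tens S t n phi (chain_delta R z))) -[RHS]/(b phi (chain_delta R z)).
  (* Only the slice at [yz] survives, and balancedness carries [thead z] from the first argument of
     [b] to the second, turning (1, yz) back into z. *)
  rewrite decay_tens_delta; pose yz : n.-tuple G := [tuple of behead (gact (thead z)^-1%g z)].
  have zE : gact (thead z)^-1%g z = [tuple of 1%g :: yz].
    by rewrite [LHS]tuple_eta thead_gact mulVg.
  rewrite /beta -(@fsbig_widen _ _ _ _ [set yz]) //; last first.
    move=> y [_ /= ny]; rewrite decay_slice_push //; case: (_ =P _) => [zy|_].
      case: ny; apply: val_inj.
      by rewrite -[RHS]/(behead (val (gact (thead z)^-1%g z))) zy.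
    exact: linear0l.
  rewrite fsbig_set1 decay_slice_push // zE eqxx balb; congr (b phi _).
  by rewrite chain_act_delta -zE gactVK.
move=> E f f' _ _ ff' x; have /asboolP[r xr _] := decay_chain_valP x.
have [s us hs] := @finite_slices G S n r.
rewrite (decay_chain_expand (xr _ erefl) us hs) !linear_sum.
by apply: eq_bigr => y _; exact: ff'.
Qed.

End DecayUniversal.

Theorem proposition10 (R : realType) (G : groupType) (S : generating_seq G)
    (t : decay R) :
  (forall Q : balanced_complex S t (C := chain_complex R G) (@chain_gact R G),
     exists F : forall n,
         {linear bc_complex Q n -> decay_chain_complex S t n},
       chain_iso F /\
       forall n (phi : decay_space S t) (c : chain R G n),
         decay_chain_val (F n (bt_class (Q n) phi c)) =
         convolution (@gact G n.+1) phi c) /\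
  (forall (P : free_resolution R G)
          (Q : balanced_complex S t (C := res_complex P) (@res_gact R G P)),
     homotopy_equivalent (bc_complex Q) (decay_chain_complex S t)).
Proof.
split=> [Q|P Q].
  pose X := chain_resolution R G.
  pose tQ n : {bilinear decay_space S t -> X n -> Q n} := mk_bilinear (bt_class_bilinear (Q n)).
  have tQP n : is_balanced_tensor (@pr_act _ _ X n) (tQ n) := bt_is_balanced_tensor (Q n).
  have tTP n : is_balanced_tensor (@pr_act _ _ X n) (decay_tens S t n) :=
    decay_tens_is_balanced_tensor S t n.
  have dQE n phi m : bc_d Q n (tQ n.+1 phi m) = tQ n phi (pr_d X n m) := bc_dE Q phi m.
  have dTE n phi m : decay_chain_boundary (decay_tens S t n.+1 phi m) =
    decay_tens S t n phi (pr_d X n m) := decay_tens_boundary phi m.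
  (* Both sides are universal for the same modules C_n(G). The identity of C_n(G) induces maps in
     both directions, which are mutually inverse by uniqueness. *)
  pose f n : {linear X n -> X n} := idfun.
  have bf n : bounded_map (f n) by exact: bounded_id.
  have [F [bF Fd FE]] := induced_chain_map (f := f) tQP tTP (@bc_d_bounded _ _ _ _ _ _ Q)
    (@decay_chain_boundary_bounded R G S t) dQE dTE bf (fun _ _ _ => erefl) (fun _ _ => erefl).
  have [K [bK Kd KE]] := induced_chain_map (f := f) tTP tQP
    (@decay_chain_boundary_bounded R G S t) (@bc_d_bounded _ _ _ _ _ _ Q)
    dTE dQE bf (fun _ _ _ => erefl) (fun _ _ => erefl).
  exists F; split; last first.
    by move=> n phi c; have := FE n phi c => /= ->; exact: decay_tens_convolution.
  split; first by split.
  exists K; first by split.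
  move=> n; split.
    apply: (bal_uniq (tQP n) (f := K n \o F n) (f' := idfun)).
    - exact: bounded_comp.
    - exact: bounded_id.
    - by move=> phi m; rewrite [LHS]/= FE KE.
  apply: (bal_uniq (tTP n) (f := F n \o K n) (f' := idfun)).
  - exact: bounded_comp.
  - exact: bounded_id.
  - by move=> phi m; rewrite [LHS]/= KE FE.
exact: (@balanced_homotopy_equivalent R G S t (free_projective_resolution P)
  (chain_resolution R G) (fun n => Q n) (fun n => decay_chain S t n)
  (fun n => mk_bilinear (bt_class_bilinear (Q n))) (decay_tens S t)
  (bc_d Q) (@decay_chain_boundary R G S t) (@bc_d_bounded _ _ _ _ _ _ Q)
  (@decay_chain_boundary_bounded R G S t) (bc_dd (Q := Q))
  (@decay_chain_boundary_boundary R G S t)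
  (fun n => bt_is_balanced_tensor (Q n)) (decay_tens_is_balanced_tensor S t)
  (@bc_dE _ _ _ _ _ _ Q) (fun n phi m => decay_tens_boundary phi m)).
Qed.
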